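(* Let $k\ge 2$. A matroid has levelness at most $k-1$ if and only if it has no minor that is a minimally $k$-level matroid. Moreover, there are only finitely many minimally $k$-level matroids up to isomorphism; in particular the class of matroids of levelness at most $k-1$ is characterized by finitely many excluded minors.
   Context: For a matroid $\mathcal{M}=(E,\mathcal{B})$, its levelness $\mathrm{Lev}(\mathcal{M})$ is the levelness of $V_{\mathcal{M}}=\{\mathbf{1}_B:B\in\mathcal{B}\}\subset\mathbb{R}^E$: for a finite point set $V$ and affine $\ell\ge0$ on $V$, $\{v:\ell(v)=0\}$ is a face; inclusion-maximal faces other than $V$ are facets and the corresponding $\ell$ facet-defining; $\mathrm{Lev}(V)$ is the least $k$ such that every facet-defining affine function takes at most $k$ distinct values on $V$. A matroid $\mathcal{M}$ is minimally $k$-level if $\mathrm{Lev}(\mathcal{M})=k$ and $\mathrm{Lev}(\mathcal{N})<\mathrm{Lev}(\mathcal{M})$ for every proper minor $\mathcal{N}$ of $\mathcal{M}$. *)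

(* Defs.v *)
From HB Require Import structures.
From mathcomp Require Import all_boot all_order all_algebra.
From mathcomp Require Import Rstruct.
From mathcomp Require Import boolp.
From Stdlib Require Rdefinitions.
Notation R := Rdefinitions.R.
Set Implicit Arguments. Unset Strict Implicit. Unset Printing Implicit Defensive.
Import Order.TTheory GRing.Theory Num.Theory.

Definition matroid_axiom (E : finType) (S : {set E}) (B : {set {set E}}) : bool :=
  [&& B != set0,
      [forall X in B, X \subset S] &
      [forall X in B, forall Y in B, forall x in X :\: Y,
          exists y in Y :\: X, (y |: (X :\ x)) \in B]].

Record matroid (E : finType) := Matroid {
  mground : {set E};
  mbases : {set {set E}};
  matroid_ax : matroid_axiom mground mbases }.

Section Matroids.
Variable E : finType.

Definition mrank (M : matroid E) (X : {set E}) : nat :=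
  \max_(B in mbases M) #|B :&: X|.

(* N = M / C \ D, for disjoint C, D contained in the ground set of M.
   Bases of M/C\D are the sets B \ (C u D) with B a basis of M such that
   B meets S\D in r(S\D) elements and C in r(C) elements. *)
Definition minor_by (N M : matroid E) (C D : {set E}) : Prop :=
  [/\ C \subset mground M, D \subset mground M, [disjoint C & D],
      mground N = mground M :\: (C :|: D) &
      mbases N = [set B :\: (C :|: D) | B in
                   [set B in mbases M |
                     (#|B :&: (mground M :\: D)| == mrank M (mground M :\: D))
                     && (#|B :&: C| == mrank M C)]]].

Definition is_minor (N M : matroid E) : Prop := exists C D, minor_by N M C D.

Definition is_proper_minor (N M : matroid E) : Prop :=
  exists C D, minor_by N M C D /\ C :|: D != set0.

(* Levelness of V_M = {1_B : B basis} in R^E.  An affine function is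
   x |-> sum_e a_e x_e + c; its value at 1_B is affval a c B. *)
Definition affval (a : {ffun E -> R}) (c : R) (X : {set E}) : R :=
  (\sum_(e in X) a e + c)%R.

Definition aff_nonneg (M : matroid E) a c : Prop :=
  forall X, X \in mbases M -> (0 <= affval a c X)%R.

(* faces, identified with the set of bases B whose point 1_B lies in them *)
Definition face_of (M : matroid E) a c : {set {set E}} :=
  [set X in mbases M | affval a c X == 0%R].

Definition is_face (M : matroid E) (F : {set {set E}}) : Prop :=
  exists a c, aff_nonneg M a c /\ F = face_of M a c.

Definition is_facet (M : matroid E) (F : {set {set E}}) : Prop :=
  [/\ is_face M F, F != mbases M &
      forall F', is_face M F' -> F' != mbases M -> F \subset F' -> F' = F].

Definition facet_defining (M : matroid E) a c : Prop :=
  aff_nonneg M a c /\ is_facet M (face_of M a c).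

Definition nvalues (M : matroid E) a c : nat :=
  size (undup [seq affval a c X | X <- enum (mbases M)]).

Definition lev_bound (M : matroid E) (k : nat) : Prop :=
  forall a c, facet_defining M a c -> (nvalues M a c <= k)%N.

Lemma lev_bound_exists (M : matroid E) : exists k, `[< lev_bound M k >].
Proof.
exists #|mbases M|; apply/asboolP => a c _; rewrite /nvalues.
apply: leq_trans (size_undup _) _.
by rewrite size_map -cardE.
Qed.

Definition Lev (M : matroid E) : nat := ex_minn (lev_bound_exists M).

Definition minimally_level (k : nat) (M : matroid E) : Prop :=
  Lev M = k /\ forall N, is_proper_minor N M -> (Lev N < Lev M)%N.

End Matroids.

Definition matroid_iso (E E' : finType) (M : matroid E) (N : matroid E') : Prop :=
  exists f : E -> E',
    [/\ {in mground M &, injective f},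
        f @: mground M = mground N &
        mbases N = [set f @: X | X : {set E} in mbases M]].

(* Main.v *)
Require Import Defs.
From mathcomp Require Import all_boot all_order all_algebra.
From mathcomp Require Import Rstruct.
From mathcomp Require Import boolp zify lra.
Set Implicit Arguments. Unset Strict Implicit. Unset Printing Implicit Defensive.
Import Order.TTheory GRing.Theory Num.Theory.

(** Write [r] for the rank function and [S] for the ground set.  By the greedy
    algorithm every facet of the base polytope is cut out by [|B :&: F| = r F]
    for some set [F] (a flacet), and [r F - |B :&: F|] takes exactly
    [lambda F + 1] values, where [lambda F = r F + r (S :\: F) - r S].  Minors
    correspond to faces of the base polytope, and every facet of a face is the
    trace of a facet, so levelness is minor-monotone.

    If every proper minor of [M] has levelness less than [k <= Lev M], then [M]
    is connected and its flacets are the [F] with [M|F] and [M/F] connected and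
    [lambda F > 0].  For [e] in [F], one of [M|F \ e] and [M|F / e] is connected
    (Tutte), so [F :\ e] is a flacet of [M \ e] or of [M / e]; deletion would keep
    [lambda], and contraction lowers it by at most one.  Minimality then forces
    [lambda F = k - 1], [r F < k], and no deletion keeps [M|F] connected.  A
    connected matroid of rank [n] has a connected spanning restriction on at most
    [n + 2 ^ n] elements, which bounds [|F|]; the dual argument bounds
    [|S :\: F|]. *)

(** * Rank functions and tight bases *)

(** Connectivity of a restriction, a contraction or a minor of these is a property of an interval
    between two sets [P] and [Q] for one fixed set function. Hence no matroid is constructed until
    its levelness is used, and duality is mere complementation of the interval.

    The delicate point of the equivalence is that levelness might jump: a matroid that is minimal
    with [k <= Lev M] could have [Lev M] larger than [k], and then it would not be minimally
    [k]-level. This is why equality for [lambda F], and not just a lower bound, has to be extracted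
    from the fact that one deletion or contraction lowers [lambda] by at most one.

    The term [2 ^ n] in the size bound comes from choosing, for every subset of a basis, one element
    that prevents this subset and its complement from separating the matroid.

    Ranks are natural numbers, so [lambda] is never written as a difference: its inequalities are
    stated with [r S] moved to the other side. *)

Lemma card_setI_split (E : finType) (B X F : {set E}) : X \subset F ->
  #|B :&: F| = #|B :&: X| + #|B :&: (F :\: X)|.
Proof.
move=> XF; rewrite -(cardsID X (B :&: F)); congr (_ + _); apply: eq_card => z.
  by rewrite !inE; case: (boolP (z \in X)) => [/(subsetP XF)->|]; rewrite ?andbT ?andbF.
by rewrite !inE; case: (z \in X) (z \in B) (z \in F) => [] [] [].
Qed.

Definition tight (E : finType) (M : matroid E) (F : {set E}) : {set {set E}} :=
  [set B in mbases M | #|B :&: F| == mrank M F].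

Section Rank.
Variables (E : finType) (M : matroid E).
Implicit Types (B F X Y Z : {set E}).
Notation V := (mbases M).
Notation S := (mground M).
Notation r := (mrank M).

Lemma bases_nonempty : exists B, B \in V.
Proof. by case/and3P: (matroid_ax M) => /set0Pn[B BV] _ _; exists B. Qed.

Lemma base_sub B : B \in V -> B \subset S.
Proof. by case/and3P: (matroid_ax M) => _ /forall_inP h _ /h. Qed.

Lemma base_exchange B B' x : B \in V -> B' \in V -> x \in B :\: B' ->
  exists2 y, y \in B' :\: B & y |: (B :\ x) \in V.
Proof.
case/and3P: (matroid_ax M) => _ _ /forall_inP h BV BV' xB.
have /forall_inP/(_ _ BV')/forall_inP/(_ _ xB)/exists_inP[y y1 y2] := h _ BV.
by exists y.
Qed.

Lemma card_exchange B B' x y : x \in B :\: B' -> y \in B' :\: B ->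
  #|B' :\: (y |: (B :\ x))| < #|B' :\: B|.
Proof.
rewrite !inE => /andP[xB' xB] /andP[yB yB'].
apply/proper_card/properP; split; last by exists y; rewrite !inE ?yB ?yB' ?eqxx.
apply/subsetP => z; rewrite !inE negb_or negb_and negbK => /andP[/andP[_ zB] zB'].
by rewrite zB' andbT; case/orP: zB => // /eqP zx; rewrite -zx zB' in xB'.
Qed.

Lemma base_card B B' : B \in V -> B' \in V -> #|B| = #|B'|.
Proof.
move=> BV; have [n] := ubnP #|B' :\: B|; elim: n B B' BV => // n IH B B' BV ltn BV'.
have [BB'|] := boolP (B \subset B').
  have [B'B|] := boolP (B' \subset B).
    by have /eqP-> : B == B' by rewrite eqEsubset BB'.
  case/subsetPn => x xB' xB.
  have [|y] := @base_exchange B' B x BV' BV; first by rewrite inE xB.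
  by rewrite inE => /andP[yB' /(subsetP BB')]; rewrite (negPf yB').
case/subsetPn => x xB xB'.
have xD : x \in B :\: B' by rewrite inE xB' xB.
have [y yD BV1] := base_exchange BV BV' xD.
rewrite -(IH _ _ BV1 _ BV') ?(leq_trans (card_exchange xD yD)) //.
move: yD; rewrite inE => /andP[yB _].
by rewrite cardsU1 !inE (negbTE yB) andbF (cardsD1 x B) xB.
Qed.

Lemma rank_ge B X : B \in V -> #|B :&: X| <= r X.
Proof. by move=> BV; apply: (leq_bigmax_cond (F := fun B => #|B :&: X|)). Qed.

Lemma tight_nonempty X : exists B, B \in tight M X.
Proof.
have [B0 B0V] := bases_nonempty.
have [|B BV e] := eq_bigmax_cond (A := mem V) (fun B => #|B :&: X|).
  by apply/card_gt0P; exists B0.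
by exists B; rewrite inE BV /= /mrank e.
Qed.

Lemma tightP B X : reflect (B \in V /\ #|B :&: X| = r X) (B \in tight M X).
Proof. by rewrite inE; apply: (iffP andP) => -[-> /eqP]. Qed.

(* Elements outside [Y] are exchanged away towards a base that meets [Y] in [r Y] elements. *)
Lemma tight_extend B Y : B \in V -> exists2 B', B' \in tight M Y & B :&: Y \subset B'.
Proof.
have [C /tightP[CV CY]] := tight_nonempty Y.
have [n] := ubnP #|C :\: B|; elim: n B => // n IH B ltn BV.
have [CB|] := boolP (B :\: C \subset Y).
  exists B; last exact: subsetIl.
  apply/tightP; split=> //; apply/eqP; rewrite eqn_leq rank_ge //= -CY.
  have := base_card BV CV; rewrite -(cardsID Y B) -(cardsID Y C).
  suff : #|B :\: Y| <= #|C :\: Y| by lia.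
  apply/subset_leq_card/subsetP => z; rewrite !inE => /andP[zY zB]; rewrite zY /=.
  by apply: contraNT zY => zC; apply: (subsetP CB); rewrite inE zC.
case/subsetPn => x xD xY; have [y yD BV1] := base_exchange BV CV xD.
have [|B' B'T sB'] := IH _ _ BV1; first exact: leq_trans (card_exchange xD yD) _.
exists B' => //; apply: subset_trans sB'.
apply/subsetP => z; rewrite !inE => /andP[zB zY]; rewrite zB zY !andbT.
by apply/orP; right; apply: contraNneq xY => <-.
Qed.

Lemma tight_chain2 X Y B : X \subset Y -> B \in tight M X ->
  exists2 B', B' \in tight M Y & B' \in tight M X /\ B :&: Y \subset B'.
Proof.
move=> XY /tightP[BV BX]; have [B' B'T sB] := tight_extend Y BV; exists B' => //.
split=> //; have [B'V _] := tightP _ _ B'T.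
apply/tightP; split=> //; apply/eqP; rewrite eqn_leq rank_ge //= -BX.
apply/subset_leq_card/subsetP => z; rewrite !inE => /andP[zB zX].
by rewrite zX andbT (subsetP sB) // inE zB (subsetP XY).
Qed.

(** Enlarging a base along a chain never loses what was gained on the smaller sets. A base that is
    tight for a whole chain turns rank inequalities into counting inside that base. *)
Lemma tight_chain3 X Y Z : X \subset Y -> Y \subset Z ->
  exists B, [/\ B \in tight M X, B \in tight M Y & B \in tight M Z].
Proof.
move=> XY YZ; have [B BX] := tight_nonempty X.
have [B1 B1Y [B1X _]] := tight_chain2 XY BX.
have [B2 B2Z [B2Y sB]] := tight_chain2 YZ B1Y.
exists B2; split=> //; have [B2V _] := tightP _ _ B2Z.
apply/tightP; split=> //; apply/eqP; rewrite eqn_leq rank_ge //=.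
have [_ <-] := tightP _ _ B1X.
apply/subset_leq_card/subsetP => z; rewrite !inE => /andP[zB zX].
by rewrite zX andbT (subsetP sB) // inE zB (subsetP YZ) // (subsetP XY).
Qed.

Lemma rankS B : B \in V -> r S = #|B|.
Proof.
move=> BV; have [B' /tightP[B'V <-]] := tight_nonempty S.
by rewrite (setIidPl (base_sub B'V)) (base_card B'V BV).
Qed.

Lemma tightS B : B \in V -> B \in tight M S.
Proof. by move=> BV; apply/tightP; rewrite (setIidPl (base_sub BV)) -rankS. Qed.

Lemma card_base_split B F : B \in V -> r S = #|B :&: F| + #|B :&: (S :\: F)|.
Proof.
move=> BV; rewrite (rankS BV) -(cardsID F B); congr (_ + _); apply: eq_card => z.
rewrite !inE; case: (boolP (z \in B)) => [/(subsetP (base_sub BV))->|];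
  by rewrite ?andbF ?andbT.
Qed.

Lemma rank_setU1 X e : r X <= r (e |: X) <= (r X).+1.
Proof.
apply/andP; split.
  have [B /tightP[BV <-]] := tight_nonempty X.
  apply: leq_trans (rank_ge _ BV); apply/subset_leq_card/setIS/subsetUr.
have [B /tightP[BV <-]] := tight_nonempty (e |: X).
apply: leq_trans (_ : #|e |: (B :&: X)| <= _).
  apply/subset_leq_card/subsetP => z; rewrite !inE => /andP[-> /orP[->|->]] //.
  by rewrite orbT.
by rewrite cardsU1; have := rank_ge X BV; case: (_ \notin _) => /=; lia.
Qed.

Lemma rank_submod X Y : r (X :&: Y) + r (X :|: Y) <= r X + r Y.
Proof.
have sI : X :&: Y \subset X :|: Y by rewrite subIset // subsetUl.
have [B [/tightP[BV e1] /tightP[_ e2] _]] := tight_chain3 sI (subxx _).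
rewrite -e1 -e2; have := rank_ge X BV; have := rank_ge Y BV.
have := cardsUI (B :&: X) (B :&: Y); rewrite -setIUr setIACA setIid; lia.
Qed.

Lemma rank_le_card X : r X <= #|X|.
Proof.
have [B /tightP[BV <-]] := tight_nonempty X; exact/subset_leq_card/subsetIr.
Qed.

(** Here the entering element is prescribed. A base inside [y |: B] that keeps [C :&: (y |: B)]
    contains [y], so it omits exactly one element of [B], and this element is outside [C]. *)
Lemma base_exchange_dual B C y : B \in V -> C \in V -> y \in C :\: B ->
  exists2 x, x \in B :\: C & y |: (B :\ x) \in V.
Proof.
move=> BV CV; rewrite inE => /andP[yB yC].
have [D DT sD] := tight_extend (y |: B) CV.
have [DV eD] := tightP _ _ DT.
have sDB : D \subset y |: B.
  apply/setIidPl/eqP; rewrite eqEcard subsetIl eD -(base_card BV DV).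
  by apply: leq_trans (rank_ge _ BV); rewrite (setIidPl _) ?subsetUr.
have yD : y \in D by apply: (subsetP sD); rewrite !inE yC eqxx.
have [BD|] := boolP (B \subset D).
  suff : #|B| < #|D| by rewrite (base_card BV DV) ltnn.
  by apply/proper_card/properP; split=> //; exists y.
case/subsetPn => x xB xD; exists x.
  by rewrite inE xB andbT; apply: contra xD => xC; apply: (subsetP sD);
    rewrite !inE xC xB orbT.
rewrite (_ : _ |: _ = D) //; apply/eqP; rewrite eq_sym eqEcard; apply/andP; split.
  apply/subsetP => z zD; rewrite !inE.
  have := subsetP sDB z zD; rewrite !inE => /orP[->//|->]; rewrite andbT.
  by apply/orP; right; apply: contraNneq xD => <-.
rewrite cardsU1 !inE (negbTE yB) andbF /= -(base_card BV DV) (cardsD1 x B) xB; lia.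
Qed.

End Rank.

(** * Facets of faces *)

Section Values.
Variables (E : finType) (M : matroid E).
Implicit Types (B F X Y Z : {set E}).
Notation V := (mbases M).
Notation S := (mground M).
Notation r := (mrank M).

(** Discrete intermediate values: an exchange raises [#|B :&: F|] by at most one, so the walk
    towards [C] skips no value on the way up. *)
Lemma base_value_between B C F j : B \in V -> C \in V ->
  #|B :&: F| <= j -> j <= #|C :&: F| -> exists2 B', B' \in V & #|B' :&: F| = j.
Proof.
move=> + CV + jC; have [n] := ubnP #|C :\: B|; elim: n B => // n IH B ltn BV.
rewrite leq_eqVlt => /orP[/eqP<-|Bj]; first by exists B.
have [BC|] := boolP (B \subset C).
  have /eqP BC' : B == C by rewrite eqEcard BC (base_card BV CV) /=.
  by rewrite BC' in Bj; lia.
case/subsetPn => x xB xC.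
have xD : x \in B :\: C by rewrite inE xC xB.
have [y yD BV1] := base_exchange BV CV xD.
apply: (IH _ _ BV1); first exact: leq_trans (card_exchange xD yD) _.
apply: leq_trans Bj; apply: leq_trans (_ : #|y |: (B :&: F)| <= _).
  apply/subset_leq_card/subsetP => z; rewrite !inE => /andP[/orP[->//|/andP[_ ->]] ->].
  by rewrite orbT.
by rewrite cardsU1; case: (_ \notin _); lia.
Qed.

(** The least value is [r S - r (S :\: F)], reached by a base that is tight for the complement of
    [F]. *)
Lemma base_valueP F j :
  (exists2 B, B \in V & #|B :&: F| = j) <-> r S <= j + r (S :\: F) /\ j <= r F.
Proof.
split=> [[B BV <-]|[h1 h2]].
  by rewrite rank_ge // (card_base_split F BV) leq_add2l rank_ge.
have [B /tightP[BV BF]] := tight_nonempty M (S :\: F).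
have [C /tightP[CV CF]] := tight_nonempty M F.
apply: (base_value_between BV CV); last by rewrite CF.
have := card_base_split F BV; lia.
Qed.

Lemma tight_properP F : reflect (r S < r F + r (S :\: F)) (tight M F != V).
Proof.
apply: (iffP idP) => [|h].
  rewrite ltnNge; apply: contra => h; apply/eqP/setP => B.
  apply/tightP/idP => [[]//|BV]; split=> //.
  have := card_base_split F BV; have := rank_ge F BV; have := rank_ge (S :\: F) BV; lia.
have [B /tightP[BV BF]] := tight_nonempty M (S :\: F).
apply/eqP => e; move: (BV); rewrite -e => /tightP[_ eF].
have := card_base_split F BV; lia.
Qed.

End Values.

(** * Rotating supporting hyperplanes of the base polytope *)

Section Affine.
Variables (E : finType) (M : matroid E).
Implicit Types (B F X Y Z : {set E}) (a b : {ffun E -> R}) (c d t : R).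
Notation V := (mbases M).
Notation S := (mground M).
Notation r := (mrank M).
Local Open Scope ring_scope.

Lemma affval_comb a c b d t X :
  affval (a + [ffun e => t * b e]) (c + t * d) X = affval a c X + t * affval b d X.
Proof.
rewrite /affval mulrDr addrACA mulr_sumr -big_split /=; congr (_ + _).
by apply: eq_bigr => e _; rewrite !ffunE.
Qed.

Lemma face_ofP a c X : reflect (X \in V /\ affval a c X = 0) (X \in face_of M a c).
Proof. by rewrite inE; apply: (iffP andP) => -[-> /eqP]. Qed.

Lemma face_proper a c : face_of M a c != V -> exists2 X, X \in V & X \notin face_of M a c.
Proof.
move=> h; have /subsetPn[X XV XF] : ~~ (V \subset face_of M a c).
  apply: contra h => h; rewrite eqEsubset h andbT.
  by apply/subsetP => X /face_ofP[].
by exists X.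
Qed.

Lemma aff_gt0 a c X : aff_nonneg M a c -> X \in V -> X \notin face_of M a c ->
  0 < affval a c X.
Proof. by move=> h XV; rewrite inE XV /= lt_neqAle eq_sym h // andbT. Qed.

(* Tilting the hyperplane of [(a, c)] around the face of [(a', c')] until it hits a new base. *)
Lemma tilt a c a' c' : aff_nonneg M a c -> aff_nonneg M a' c' ->
  face_of M a c \subset face_of M a' c' -> face_of M a' c' != V ->
  exists t b d, [/\ aff_nonneg M b d,
    forall X, affval b d X = affval a c X - t * affval a' c' X &
    exists X, [/\ X \in V, X \notin face_of M a' c' & affval b d X = 0]].
Proof.
move=> pa pa' sF /face_proper[X0 X0V X0F].
(* The minimal ratio is the largest factor that keeps the difference nonnegative; bases on the face
   of [(a', c')] put no constraint on it. *)
pose q X := affval a c X / affval a' c' X.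
have [|X1 /andP[X1V X1F] minq] :=
  @arg_minP _ R _ X0 [pred X | (X \in V) && (X \notin face_of M a' c')] q.
  by rewrite /= X0V X0F.
have p1 := aff_gt0 pa' X1V X1F.
have ev X : affval (a + [ffun e => - q X1 * a' e]) (c + - q X1 * c') X
            = affval a c X - q X1 * affval a' c' X.
  by rewrite affval_comb mulNr.
exists (q X1), (a + [ffun e => - q X1 * a' e]), (c + - q X1 * c').
split; [|exact: ev|exists X1; split=> //].
  move=> X XV; rewrite ev; have [/face_ofP[_ ->]|XF] := boolP (X \in face_of M a' c').
    by rewrite mulr0 subr0 pa.
  have p0 := aff_gt0 pa' XV XF.
  by rewrite subr_ge0 -ler_pdivlMr // minq //= XV XF.
by rewrite ev /q divfK ?subrr // gt_eqF.
Qed.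

(** Tilting a facet around its own face gains a base. By maximality the tilted function, which is
    [(a, c)] minus a multiple of [(a', c')], then vanishes at every base. *)
Lemma facet_proportional a c a' c' : facet_defining M a c -> aff_nonneg M a' c' ->
  face_of M a c = face_of M a' c' ->
  exists t, 0 < t /\ forall X, X \in V -> affval a c X = t * affval a' c' X.
Proof.
move=> [pa [_ nV maxF]] pa' eF.
have sF' : face_of M a c \subset face_of M a' c' by rewrite eF.
have nV' : face_of M a' c' != V by rewrite -eF.
have [t [b [d [pb ev [X1 [X1V X1F X10]]]]]] := tilt pa pa' sF' nV'.
have sF : face_of M a c \subset face_of M b d.
  apply/subsetP => X XF; have [XV X0] := face_ofP _ _ _ XF.
  by move: XF; rewrite eF => /face_ofP[_ X0']; apply/face_ofP; rewrite ev X0 X0' mulr0 subr0.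
have bV : face_of M b d = V.
  apply/eqP; apply: contraNT X1F => bV; rewrite -eF -(maxF (face_of M b d)) //.
    exact/face_ofP.
  by exists b, d.
have e X : X \in V -> affval a c X = t * affval a' c' X.
  by move=> XV; apply/eqP; rewrite -subr_eq0 -ev; move: XV; rewrite -bV => /face_ofP[_ ->].
exists t; split=> //.
have := aff_gt0 pa X1V; rewrite eF => /(_ X1F); rewrite e //.
by rewrite pmulr_lgt0 // aff_gt0.
Qed.

Lemma nvalues_sub (E' : finType) (M' : matroid E') a c (a' : {ffun E' -> R}) c' t :
  t != 0 ->
  (forall X, X \in V -> exists2 X', X' \in mbases M' & affval a' c' X' = t * affval a c X) ->
  (nvalues M a c <= nvalues M' a' c')%N.
Proof.
move=> t0 h; rewrite /nvalues -(size_map (fun x => t * x) (undup _)).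
apply: uniq_leq_size; first by rewrite map_inj_uniq ?undup_uniq //; apply: mulfI.
move=> _ /mapP[x + ->]; rewrite !mem_undup => /mapP[X]; rewrite mem_enum => XV ->.
by have [X' X'V <-] := h X XV; apply: map_f; rewrite mem_enum.
Qed.

(** Meant for [P2] a face and [P1] a facet of that face: it produces a facet of the whole polytope
    through [P1] that does not contain [P2]. *)
Lemma rotate_to_facet (P1 P2 : {set {set E}}) a c : aff_nonneg M a c ->
  P1 \subset face_of M a c -> P2 \subset V -> ~~ (P2 \subset face_of M a c) ->
  exists a' c', [/\ facet_defining M a' c', P1 \subset face_of M a' c' &
                    ~~ (P2 \subset face_of M a' c')].
Proof.
move=> + + sP2; have [n] := ubnP (#|V| - #|face_of M a c|).
elim: n a c => // n IH a c ltn pa sP1 nP2.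
have sfV b d : face_of M b d \subset V by apply/subsetP => X /face_ofP[].
have [hmax|] := pselect (forall F' : {set {set E}}, is_face M F' -> F' != V ->
   face_of M a c \subset F' ->
   F' = face_of M a c).
  exists a, c; split=> //; split=> //; split=> //; first by exists a, c.
  by apply: contraNneq nP2 => ->.
move=> /existsNP[_ /not_implyP[[a1 [c1 [p1 ->]]]]] /not_implyP[nV1] /not_implyP[s1 ne1].
have lt b d : face_of M a c \subset face_of M b d -> face_of M b d <> face_of M a c ->
    (#|V| - #|face_of M b d| < n)%N.
  move=> s ne; have : face_of M a c \proper face_of M b d.
    by rewrite properEneq s andbT eq_sym; apply/eqP.
  move/proper_card; have := subset_leq_card (sfV b d); lia.
have [sP2'|] := boolP (P2 \subset face_of M a1 c1); last first.
  exact: IH (lt _ _ s1 ne1) p1 (subset_trans sP1 s1).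
(* The larger face swallows [P2]. Tilting around it does not change the values on [P2], so the new
   face still misses a point of [P2], and it has gained [X1]. *)
have [t [b [d [pb ev [X1 [X1V X1F X10]]]]]] := tilt pa p1 s1 nV1.
have s2 : face_of M a c \subset face_of M b d.
  apply/subsetP => X XF; apply/face_ofP; have /face_ofP[XV XF'] := subsetP s1 X XF.
  by move: XF => /face_ofP[_ XF]; rewrite ev XF XF' mulr0 subr0.
apply: (IH b d) => //; first 1 last.
- exact: subset_trans sP1 s2.
- case/subsetPn: nP2 => X XP XF; apply/subsetPn; exists X => //.
  apply: contra XF => /face_ofP[XV]; rewrite ev.
  have /face_ofP[_ ->] := subsetP sP2' X XP.
  by rewrite mulr0 subr0 => h; apply/face_ofP.
apply: lt => // e; have : X1 \in face_of M b d by apply/face_ofP.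
by rewrite e => /(subsetP s1); rewrite (negPf X1F).
Qed.

End Affine.

Lemma lev_boundP (E : finType) (M : matroid E) k : (Lev M <= k)%N <-> lev_bound M k.
Proof.
rewrite /Lev; case: ex_minnP => m /asboolP bm minm; split=> [mk a c h|b].
  exact: leq_trans (bm _ _ h) mk.
by apply: minm; apply/asboolP.
Qed.

(** A map on bases with affine functions carried both ways covers minors as well as isomorphisms. A
    facet-defining function of [N] is moved to [M], made nonnegative by adding a multiple of the
    function of the face, and rotated into a facet of [M]. The pullback of that facet is
    proportional to the original function, so no value gets lost. *)
Lemma Lev_face_embed (E E' : finType) (M : matroid E) (N : matroid E')
    (phi : {set E'} -> {set E}) :
  is_face M (phi @: mbases N) ->
  (forall a c, exists a' c', forall X, X \in mbases N -> affval a' c' X = affval a c (phi X)) ->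
  (forall a' c', exists a c, forall X, X \in mbases N -> affval a' c' X = affval a c (phi X)) ->
  (Lev N <= Lev M)%N.
Proof.
move=> [a0 [c0 [p0 F0]]] pull push; apply/lev_boundP => a' c' fN.
have /lev_boundP/= boundM := leqnn (Lev M).
have [pa' [_ nV' maxF']] := fN.
have [a1 [c1 e1]] := push a' c'.
have phiV X : X \in mbases N -> phi X \in mbases M.
  by move=> XN; have /face_ofP[] : phi X \in face_of M a0 c0 by rewrite -F0 imset_f.
have phi0 X : X \in mbases N -> affval a0 c0 (phi X) = 0%R.
  by move=> XN; have /face_ofP[] : phi X \in face_of M a0 c0 by rewrite -F0 imset_f.
have [s hs] : exists s : R, forall X, X \in mbases M -> X \notin face_of M a0 c0 ->
     (0 < affval a1 c1 X + s * affval a0 c0 X)%R.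
  (* The summand of [X] times the value of [(a0, c0)] at [X] already exceeds the absolute value of
     [(a1, c1)] there, and the other summands are nonnegative. Bases on the face contribute 0, as
     division by 0 gives 0. *)
  exists (\sum_(X in mbases M) (`|affval a1 c1 X| + 1) / `|affval a0 c0 X|)%R => X XV XF.
  have := aff_gt0 p0 XV XF => lt0.
  rewrite (bigD1 X XV) /= mulrDl (gtr0_norm lt0) divfK ?gt_eqF //.
  set u := (\sum_(_ | _) _)%R; have : (0 <= u * affval a0 c0 X)%R.
    apply: mulr_ge0; last exact: ltW.
    by apply: sumr_ge0 => Y _; apply: divr_ge0; rewrite ?addr_ge0.
  have := ler_norm (- affval a1 c1 X)%R; rewrite normrN; lra.
pose a2 := (a1 + [ffun e => s * a0 e])%R; pose c2 := (c1 + s * c0)%R.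
have e2 X : X \in mbases N -> affval a2 c2 (phi X) = affval a' c' X.
  by move=> XN; rewrite affval_comb phi0 // mulr0 addr0 e1.
have p2 : aff_nonneg M a2 c2.
  move=> X XV; have [|XF] := boolP (X \in face_of M a0 c0).
    by rewrite -F0 => /imsetP[Y YN ->]; rewrite e2 // pa'.
  by rewrite affval_comb ltW // hs.
have [X1 X1N X1F] := face_proper nV'.
have [||||a3 [c3 [f3 s3 n3]]] := @rotate_to_facet _ M
   (phi @: face_of N a' c') (phi @: mbases N) a2 c2 => //.
- apply/subsetP => _ /imsetP[X /face_ofP[XN X0] ->]; apply/face_ofP; split.
    exact: phiV.
  by rewrite e2.
- by rewrite F0; apply/subsetP => X /face_ofP[].
- apply/subsetPn; exists (phi X1); first exact: imset_f.
  apply: contra X1F => /face_ofP[_]; rewrite e2 // => h; exact/face_ofP.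
apply: leq_trans (boundM _ _ f3); have [p3 _] := f3.
have [a4 [c4 e4]] := pull a3 c3.
have p4 : aff_nonneg N a4 c4 by move=> X XN; rewrite e4 // p3 // phiV.
(* The pulled back face contains the given facet of [N], and it is proper because [n3] keeps the
   image of some base of [N] off the facet of [M]. *)
have F4 : face_of N a4 c4 = face_of N a' c'.
  apply: maxF'.
  - by exists a4, c4.
  - apply: contraNneq n3 => e; apply/subsetP => _ /imsetP[X XN ->].
    apply/face_ofP; split; first exact: phiV.
    by rewrite -e4 //; move: XN; rewrite -{1}e => /face_ofP[].
  - apply/subsetP => X XF; have [XN _] := face_ofP _ _ _ _ XF.
    apply/face_ofP; split=> //; rewrite e4 //.
    by have /face_ofP[] := subsetP s3 _ (imset_f phi XF).
have [t [t0 et]] := facet_proportional fN p4 (esym F4).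
have t0' : (t^-1 != 0)%R by rewrite invr_eq0 gt_eqF.
apply: (nvalues_sub t0') => X XN; exists (phi X); first exact: phiV.
by rewrite et // mulKf ?gt_eqF // e4.
Qed.

(** * Flacets *)

(** Maximality is tested only among faces of the form [tight M F']; by [face_sub_tight] this already
    makes the face a facet. Faces are compared instead of sets, because different sets may cut out
    the same face. *)
Definition flacet (E : finType) (M : matroid E) (F : {set E}) : Prop :=
  [/\ F \subset mground M, tight M F != mbases M &
      forall F' : {set E}, F' \subset mground M -> tight M F' != mbases M ->
        tight M F \subset tight M F' -> tight M F' = tight M F].

Definition cut (E : finType) (F : {set E}) : {ffun E -> R} :=
  [ffun e => if e \in F then (-1)%R else 0%R].

Section Flacets.
Variables (E : finType) (M : matroid E).
Implicit Types (A B C D F X Y Z : {set E}) (a b : {ffun E -> R}) (c d t : R).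
Notation V := (mbases M).
Notation S := (mground M).
Notation r := (mrank M).

Lemma affval_cut F c X : affval (cut F) c X = (c - #|X :&: F|%:R)%R.
Proof.
rewrite /affval addrC; congr (_ + _)%R.
rewrite (eq_bigr (fun e => if e \in F then -1 else 0)%R); last by move=> e _; rewrite ffunE.
by rewrite -big_mkcondr /= -sum1_card natr_sum -sumrN; apply: eq_bigl => e; rewrite inE.
Qed.

Lemma cut_nonneg F : aff_nonneg M (cut F) (r F)%:R%R.
Proof. by move=> X XV; rewrite affval_cut subr_ge0 ler_nat rank_ge. Qed.

Lemma face_of_cut F : face_of M (cut F) (r F)%:R%R = tight M F.
Proof.
apply/setP => X; rewrite !inE affval_cut subr_eq0 eqr_nat.
by rewrite eq_sym.
Qed.

Lemma tight_is_face F : is_face M (tight M F).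
Proof. by exists (cut F), (r F)%:R%R; rewrite face_of_cut; split=> //; apply: cut_nonneg. Qed.

Lemma nvalues_cut F :
  (r S + nvalues M (cut F) (r F)%:R%R = (r F + r (S :\: F)).+1)%N.
Proof.
pose m := r S - r (S :\: F).
have [B /tightP[BV BF]] := tight_nonempty M (S :\: F).
have sB := card_base_split F BV; have rB := rank_ge F BV.
pose g (j : nat) : R := ((r F)%:R - j%:R)%R.
have inj_g : injective g by move=> i j /addrI/oppr_inj/eqP; rewrite eqr_nat => /eqP.
have -> : nvalues M (cut F) (r F)%:R%R = size (map g (iota m (r F - m).+1)).
  apply/perm_size/uniq_perm; rewrite ?undup_uniq ?(map_inj_uniq inj_g) ?iota_uniq //.
  move=> x; rewrite mem_undup; apply/mapP/mapP => [[X]|[j]].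
    rewrite mem_enum => XV ->; rewrite affval_cut; exists #|X :&: F| => //.
    have [|h1 h2] := (base_valueP M F #|X :&: F|).1; first by exists X.
    by rewrite mem_iota /m; lia.
  rewrite mem_iota => hj ->; have [|X XV Xj] := (base_valueP M F j).2.
    by rewrite /m in hj; lia.
  by exists X; rewrite ?mem_enum // affval_cut Xj.
rewrite size_map size_iota /m; lia.
Qed.

Lemma affval_exchange a c B x y : x \in B -> y \notin B ->
  affval a c (y |: (B :\ x)) = (affval a c B + a y - a x)%R.
Proof.
move=> xB yB; rewrite /affval big_setU1 /= ?inE ?(negPf yB) ?andbF //.
by rewrite (big_setD1 x xB) /=; lra.
Qed.

(** On a walk from [C] to [B] by exchanges some step enters the face. That step shows which
    threshold on the weights [a] to use in [face_sub_tight]. *)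
Lemma face_boundary_exchange a c B C : B \in face_of M a c -> C \in V ->
  C \notin face_of M a c ->
  exists D x y, [/\ D \in V, D \notin face_of M a c, x \in D, y \notin D &
                    y |: (D :\ x) \in face_of M a c].
Proof.
move=> BF; have [BV _] := face_ofP _ _ _ _ BF.
have [n] := ubnP #|B :\: C|; elim: n C => // n IH C ltn CV CF.
have [CB|] := boolP (C \subset B).
  have /eqP CB' : C == B by rewrite eqEcard CB (base_card CV BV) /=.
  by rewrite CB' BF in CF.
case/subsetPn => x xC xB; have xD : x \in C :\: B by rewrite inE xB xC.
have [y yD DV] := base_exchange CV BV xD.
have [DF|DF] := boolP (y |: (C :\ x) \in face_of M a c).
  by exists C, x, y; split=> //; move: yD; rewrite inE => /andP[].
exact: IH (leq_trans (card_exchange xD yD) _) DV DF.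
Qed.

(* Greedy algorithm: bases of minimal [a]-weight meet each sublevel set of [a] maximally. *)
Lemma face_sub_tight a c B : aff_nonneg M a c -> B \in face_of M a c ->
  face_of M a c != V ->
  exists F, [/\ F \subset S, face_of M a c \subset tight M F & tight M F != V].
Proof.
move=> pa BF /face_proper[C CV CF].
have [D [x [y [DV DF xD yD EF]]]] := face_boundary_exchange BF CV CF.
have [EV E0] := face_ofP _ _ _ _ EF.
have axy : (a y < a x)%R.
  by have := aff_gt0 pa DV DF; move: E0; rewrite affval_exchange //; lra.
(* The exchange into the face strictly lowers the weight, so this threshold separates [y] from
   [x]. *)
pose F := [set e in S | (a e <= a y)%R].
have yF : y \in F by rewrite inE lexx (subsetP (base_sub EV)) // !inE eqxx.
have xF : x \notin F by rewrite inE leNgt axy andbF.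
exists F; split; first by apply/subsetP => e; rewrite inE => /andP[].
  apply/subsetP => X XF; have [XV X0] := face_ofP _ _ _ _ XF.
  apply/tightP; split=> //; apply/eqP; rewrite eqn_leq rank_ge //= leqNgt.
  apply/negP => lt; have [Y YT sY] := tight_extend F XV; have [YV YF] := tightP _ _ _ YT.
  have /subsetPn[y' + y'X] : ~~ (Y :&: F \subset X).
    apply: contraTN lt => h; rewrite -leqNgt -YF; apply: subset_leq_card.
    by rewrite subsetI h subsetIr.
  rewrite inE => /andP[y'Y y'F].
  (* If [X] is not tight for [F], then trading some [x'] outside [F] for [y'] in [F] pushes the
     value of [X] below 0. *)
  have [|x' + ZV] := base_exchange_dual XV YV (y := y'); first by rewrite inE y'X.
  rewrite inE => /andP[x'Y x'X].
  have x'F : x' \notin F by apply: contra x'Y => h; apply: (subsetP sY); rewrite inE x'X.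
  have lt1 : (a y < a x')%R.
    by move: x'F; rewrite inE (subsetP (base_sub XV)) //= -ltNge.
  have lt2 : (a y' <= a y)%R by move: y'F; rewrite inE => /andP[].
  have := pa _ ZV; rewrite affval_exchange // X0; lra.
(* [D] is not tight for [F]: trading [x] outside [F] for [y] in [F] gains an element of [F]. *)
apply/eqP => eV; move: DV; rewrite -eV => /tightP[DV DrF].
have := rank_ge F EV; rewrite -DrF (_ : (y |: (D :\ x)) :&: F = y |: (D :&: F)).
  by rewrite cardsU1 !inE (negPf yD) /=; lia.
apply/setP => z; rewrite !inE; case: (z =P y) => [->|_] /=.
  by move: yF; rewrite inE.
by case: (z =P x) => [->|_] //=; move: xF; rewrite inE => /negPf->; rewrite andbF.
Qed.

(** Vertices are faces of the form [tight M F]. This excludes the empty face as a facet once there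
    are two bases. *)
Lemma tight_base B : B \in V -> tight M B = [set B].
Proof.
move=> BV; apply/setP => C; rewrite inE.
have rB : r B = #|B|.
  by apply/eqP; rewrite eqn_leq rank_le_card; have := rank_ge B BV; rewrite setIid.
rewrite inE; apply/andP/eqP => [[CV /eqP e]|->]; last by rewrite BV setIid rB.
have BC : B \subset C.
  by apply/setIidPr/eqP; rewrite eqEcard subsetIr e rB leqnn.
by apply/esym/eqP; rewrite eqEcard BC (base_card CV BV) /=.
Qed.

Lemma flacet_facet_defining F : flacet M F -> facet_defining M (cut F) (r F)%:R%R.
Proof.
move=> [FS nV maxF]; split; first exact: cut_nonneg.
rewrite face_of_cut; split; [exact: tight_is_face|by []|].
move=> _ [a [c [pa ->]]] nV' sF.
have [B BT] := tight_nonempty M F.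
have [F' [F'S sF' nVF']] := face_sub_tight pa (subsetP sF _ BT) nV'.
apply/eqP; rewrite eqEsubset sF andbT.
by rewrite -(maxF F') // (subset_trans sF).
Qed.

Lemma flacet_Lev F : flacet M F -> (r F + r (S :\: F) < r S + Lev M)%N.
Proof.
move/flacet_facet_defining => fF; have /lev_boundP/(_ _ _ fF) := leqnn (Lev M).
by have := nvalues_cut F; lia.
Qed.

(** A matroid with a single base has the empty face as its facet, and no set [F] cuts that out;
    asking for two values excludes this case. *)
Lemma facet_defining_flacet a c : facet_defining M a c -> (1 < nvalues M a c)%N ->
  exists2 F, flacet M F & nvalues M a c = nvalues M (cut F) (r F)%:R%R.
Proof.
move=> fa; have [pa [_ nV maxF]] := fa => n1.
have V1 : (1 < #|V|)%N.
  by apply: leq_trans n1 _; apply: leq_trans (size_undup _) _; rewrite size_map -cardE.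
have [B BF] : exists B, B \in face_of M a c.
  have [e|[C CF]] := set_0Vmem (face_of M a c); last by exists C.
  have [B BV] := bases_nonempty M; exists B.
  have <- : tight M B = face_of M a c; last by rewrite tight_base // inE.
  apply: maxF; [exact: tight_is_face| |by rewrite e sub0set].
  by apply: contraTneq V1 => <-; rewrite tight_base // cards1.
have [F [FS sF nVF]] := face_sub_tight pa BF nV.
have eF := maxF _ (tight_is_face F) nVF sF.
exists F.
  by split=> // F' _ nV' sF'; rewrite eF; apply: maxF => //;
    [exact: tight_is_face|rewrite -eF].
have e : face_of M a c = face_of M (cut F) (r F)%:R%R by rewrite face_of_cut.
have [t [t0 et]] := facet_proportional fa (cut_nonneg F) e.
have tn0 : t != 0%R by rewrite gt_eqF.
apply/eqP; rewrite eqn_leq; apply/andP; split; last first.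
  by apply: (nvalues_sub tn0) => X XV; exists X => //; apply: et.
have tv0 : (t^-1 != 0)%R by rewrite invr_eq0.
by apply: (nvalues_sub tv0) => X XV; exists X => //; rewrite et // mulKf.
Qed.

Lemma Lev_flacet k : (1 < k)%N -> (k <= Lev M)%N ->
  exists2 F, flacet M F & (r S + k <= (r F + r (S :\: F)).+1)%N.
Proof.
move=> k1 kL; apply: contrapT => h.
have : (Lev M <= k.-1)%N; last by lia.
apply/lev_boundP => a c fa.
case: (leqP (nvalues M a c) 1) => [|n1]; first by lia.
have [F fF ->] := facet_defining_flacet fa n1.
have eF := nvalues_cut F; rewrite leqNgt; apply/negP => lt; apply: h.
by exists F => //; lia.
Qed.

(** The slacks [r F - #|B :&: F|] and [r A - #|B :&: A|] are proportional by [facet_proportional].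
    Both are integral and both take the value 1, so the factor is 1. *)
Lemma flacet_eq_value F A B : flacet M F -> tight M A = tight M F -> B \in V ->
  (r F + #|B :&: A| = r A + #|B :&: F|)%N.
Proof.
move=> fF eA BV; have [_ nV _] := fF.
have [|t [t0 et]] := facet_proportional (flacet_facet_defining fF) (cut_nonneg A).
  by rewrite !face_of_cut.
have near X : tight M X != V -> exists2 C, C \in V & r X = #|C :&: X|.+1.
  move/tight_properP => h; have [|C CV eC] := (base_valueP M X (r X).-1).2.
    have := rank_ge X BV; have := rank_ge (S :\: X) BV; have := card_base_split X BV; lia.
  exists C => //; rewrite eC prednK //.
  have [D /tightP[DV DX]] := tight_nonempty M (S :\: X).
  have := card_base_split X DV; lia.
have [C CV eC] := near _ nV.
have [|D DV eD] := near A; first by rewrite eA.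
have et' X : X \in V ->
    ((r F - #|X :&: F|)%N%:R = t * (r A - #|X :&: A|)%N%:R :> R)%R.
  by move=> XV; have := et X XV; rewrite !affval_cut !natrB ?rank_ge.
have := et' _ CV; rewrite eC subSnn => tC.
have := et' _ DV; rewrite eD subSnn mulr1 => tD.
have := et' _ BV; rewrite -tD => /eqP; rewrite -natrM eqr_nat.
have : ((r F - #|D :&: F|)%N%:R * (r A - #|C :&: A|)%N%:R = 1%N%:R :> R)%R.
  by rewrite tD -tC.
rewrite -natrM => /eqP; rewrite eqr_nat muln_eq1 => /andP[/eqP -> _].
by have := rank_ge A BV; have := rank_ge F BV; lia.
Qed.

End Flacets.

(** * Connectivity of rank functions *)

(** The value at the empty set is left free, so that [corank], a dual rank shifted by a constant,
    qualifies too. *)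
Definition rank_like (E : finType) (f : {set E} -> nat) : Prop :=
  (forall X e, f X <= f (e |: X) <= (f X).+1) /\
  (forall X Y, f (X :&: Y) + f (X :|: Y) <= f X + f Y).

(* For a matroid rank function: the minor of [Q] obtained by contracting [P] is connected. *)
Definition conn (E : finType) (f : {set E} -> nat) (P Q : {set E}) : Prop :=
  forall A C : {set E}, A :|: C = Q -> A :&: C = P -> f A + f C <= f P + f Q ->
    A = P \/ C = P.

(** * Set algebra by Boolean case analysis at one point *)

Lemma mem_eq (E : finType) (A B : {set E}) : A = B -> forall z, (z \in A) = (z \in B).
Proof. by move=> ->. Qed.

Lemma mem_sub (E : finType) (A B : {set E}) :
  A \subset B -> forall z, (z \in A) ==> (z \in B).
Proof. by move=> AB z; apply/implyP/(subsetP AB). Qed.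

Ltac pointwise z :=
  repeat match goal with
  | H : ?A = ?B |- _ => move: (mem_eq H z); clear H
  | H : is_true (?A \subset ?B) |- _ => move: (mem_sub H z); clear H
  end; rewrite !inE.
Ltac bool_cases :=
  repeat match goal with
  | |- context [in_mem ?z ?A] => case: (in_mem z A)
  | |- context [?x == ?y] => case: (x == y)
  end; by [].
Ltac setdec := let z := fresh "z" in apply/setP => z; pointwise z; bool_cases.
Ltac subdec :=
  let z := fresh "z" in apply/subsetP => z; apply/implyP; pointwise z; bool_cases.
Ltac setdec1 e eQ eP := let z := fresh "z" in
  apply/setP => z; pointwise z; case: (z =P e) => [->|_]; rewrite ?eQ ?(negPf eP); bool_cases.

Ltac nat_lia := intros; repeat match goal with
  | H : ?T |- _ => lazymatch T with
    | is_true (_ <= _) => fail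
    | _ = _ :> nat => fail
    | _ => clear H
    end
  end; lia.

Section RankLike.
Variables (E : finType) (f : {set E} -> nat).
Hypothesis rf : rank_like f.
Implicit Types (A B C F P Q X Y Z : {set E}).

Lemma rank_like_mono X Y : X \subset Y -> f X <= f Y.
Proof.
have [n] := ubnP #|Y :\: X|; elim: n X => // n IH X ltn XY.
have [YX|] := boolP (Y \subset X).
  by have /eqP-> : X == Y by rewrite eqEsubset XY.
case/subsetPn => e eY eX; have [/(_ X e)/andP[h _] _] := rf.
apply: leq_trans h (IH _ _ _); last by rewrite subUset sub1set eY.
apply: leq_trans (_ : #|Y :\: X| <= _) => //; apply: proper_card; apply/properP; split.
  by apply: setDS; apply: subsetUr.
by exists e; rewrite !inE ?eX ?eY ?eqxx.
Qed.

Lemma rank_like_closure X Y : X \subset Y ->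
  (forall e, e \in Y -> f (e |: X) <= f X) -> f Y = f X.
Proof.
have [n] := ubnP #|Y :\: X|; elim: n Y => // n IH Y ltn XY h.
have [YX|] := boolP (Y \subset X).
  by have /eqP-> : X == Y by rewrite eqEsubset XY.
case/subsetPn => e eY eX.
have sX : X \subset Y :\ e by rewrite subsetD1 XY eX.
have e1 : f (Y :\ e) = f X.
  apply: IH => //; last by move=> z; rewrite inE => /andP[_ /h].
  apply: leq_trans (_ : #|Y :\: X| <= _) => //; apply: proper_card; apply/properP; split.
    exact/setSD/subD1set.
  by exists e; rewrite !inE ?eX ?eY ?eqxx.
have [_ /(_ (Y :\ e) (e |: X))] := rf.
have -> : (Y :\ e) :&: (e |: X) = X.
  apply/setP => z; rewrite !inE; have := subsetP XY z.
  case: (z =P e) => [->|_] /=; first by rewrite (negPf eX).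
  by case: (z \in X) => [->|] //; rewrite andbF.
have -> : (Y :\ e) :|: (e |: X) = Y by rewrite setUA (setUC _ [set e]) setD1K // (setUidPl XY).
have := h e eY; have := rank_like_mono XY; lia.
Qed.

(* Tutte's uncrossing argument *)
Lemma conn_step P Q e : P \subset Q -> conn f P Q -> e \in Q -> e \notin P ->
  conn f P (Q :\ e) \/ conn f (e |: P) Q.
Proof.
move=> PQ cPQ eQ eP; apply: contrapT => /not_orP[].
move=> /existsNP[A /existsNP[C /not_implyP[AC /not_implyP[ACP /not_implyP[fAC]]]]].
move=> /not_orP[AP CP].
move=> /existsNP[A' /existsNP[C' /not_implyP[AC' /not_implyP[ACP' /not_implyP[fAC']]]]].
move=> /not_orP[AP' CP'].
have fe : f (e |: P) + f (Q :\ e) <= (f P + f Q).+1.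
  have [/(_ P e) /andP[_ h] _] := rf.
  have := rank_like_mono (subD1set Q e); lia.
(* The four ranks sum to at most [2 * (f P + f Q) + 1], so one of the two uncrossed pairs has sum at
   most [f P + f Q]. Its union contains [e], hence its intersection is the trivial side. *)
have uncross X Y X' Y' : X :|: Y = Q :\ e -> X :&: Y = P -> X' :|: Y' = Q ->
    X' :&: Y' = e |: P -> f X + f Y + (f X' + f Y') <= (f P + f Q).*2.+1 ->
    X :&: X' = P \/ Y :&: Y' = P.
  move=> h1 h2 h3 h4 le.
  have [_ sm] := rf; have := sm X X'; have := sm Y Y' => s1 s2.
  have [l|l] : f (X :&: X') + f (Y :|: Y') <= f P + f Q \/
               f (Y :&: Y') + f (X :|: X') <= f P + f Q by lia.
  - case: (cPQ _ _ _ _ l); [by setdec1 e eQ eP|by setdec1 e eQ eP|by left|].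
    move=> h; move: eP; rewrite -h !inE; move: (mem_eq h3 e) (mem_eq h4 e);
        rewrite !inE eqxx eQ /=; case: (e \in Y') => //; rewrite ?andbF ?orbT //.
  - case: (cPQ _ _ _ _ l); [by setdec1 e eQ eP|by setdec1 e eQ eP|by right|].
    move=> h; move: eP; rewrite -h !inE; move: (mem_eq h3 e) (mem_eq h4 e);
        rewrite !inE eqxx eQ /=; case: (e \in X') => //; rewrite ?andbF ?orbT //.
(* Uncrossing with both orders of the second separation leaves four cases, and each makes one of
   [A], [C], [A'], [C'] trivial. *)
have [h1|h1] := uncross A C A' C' AC ACP AC' ACP' ltac:(lia);
have [h2|h2] := uncross A C C' A' AC ACP ltac:(by rewrite setUC) ltac:(by rewrite setIC) ltac:(lia).
- by apply: AP; setdec1 e eQ eP.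
- by apply: AP'; setdec1 e eQ eP.
- by apply: CP'; setdec1 e eQ eP.
- by apply: CP; setdec1 e eQ eP.
Qed.

End RankLike.

(** * Size of connected minors in which no deletion stays connected *)

Section ConnBound.
Variables (E : finType) (f : {set E} -> nat).
Hypothesis rf : rank_like f.
Implicit Types (A B C F P Q X Y Z : {set E}).

(** Splitting off [e] alone is not a separation, so [e] is neither a loop nor a coloop of the
    minor. *)
Lemma conn_lt P Q e : P \subset Q -> conn f P Q -> e \in Q -> e \notin P -> 1 < #|Q :\: P| ->
  f P + f Q < f (e |: P) + f (Q :\ e).
Proof.
move=> PQ cPQ eQ eP ltPQ; rewrite ltnNge; apply/negP => le.
case: (cPQ _ _ _ _ le).
- by setdec1 e eQ eP.
- by setdec1 e eQ eP.
- by move=> h; move: eP; rewrite -h !inE eqxx.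
- move=> h; move: ltPQ; suff -> : Q :\: P = [set e] by rewrite cards1.
  by setdec1 e eQ eP.
Qed.

Lemma rank_basis P Q : P \subset Q ->
  exists A, [/\ P \subset A, A \subset Q, f A = f Q & #|A :\: P| <= f Q - f P].
Proof.
have [n] := ubnP (f Q - f P); elim: n P => // n IH P ltn PQ.
have [h|] := pselect (forall e, e \in Q -> f (e |: P) <= f P).
  by exists P; rewrite subxx PQ setDv cards0 (rank_like_closure rf PQ h).
move=> /existsNP[e /not_implyP[eQ /negP]]; rewrite -ltnNge => lt.
have sPQ : e |: P \subset Q by rewrite subUset sub1set eQ.
have [|A [h1 h2 h3 h4]] := IH (e |: P) _ sPQ.
  by have := rank_like_mono rf sPQ; lia.
exists A; split=> //; first exact: subset_trans (subsetUr _ _) h1.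
have := rank_like_mono rf sPQ.
have : #|A :\: P| <= #|e |: (A :\: (e |: P))|.
  by apply/subset_leq_card/subsetP => z; rewrite !inE; case: (z =P e).
have := cardsU1 e (A :\: (e |: P)); case: (_ \notin _) => /=; lia.
Qed.

Lemma rank_like_card P X : P \subset X -> f X <= f P + #|X :\: P|.
Proof.
have [n] := ubnP #|X :\: P|; elim: n P => // n IH P ltn PX.
have [XP|] := boolP (X \subset P).
  have /eqP-> : X == P by rewrite eqEsubset XP.
  exact: leq_addr.
case/subsetPn => e eX eP; have [/(_ P e)/andP[_ h] _] := rf.
have sX : e |: P \subset X by rewrite subUset sub1set eX.
have c : #|X :\: P| = #|X :\: (e |: P)|.+1.
  rewrite (cardsD1 e (X :\: P)) inE eX eP /= add1n; congr _.+1; apply: eq_card => z.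
  by rewrite !inE negb_or andbA.
have := IH (e |: P) ltac:(lia) sX; lia.
Qed.

(** Let [A0] be a basis of [Q] over [P]. For every nontrivial part [X] of [A0] some element [g X]
    raises the rank of both [X] and its complement in [A0]. An element outside [A0] and all the
    [g X] can be deleted: a separation of the rest would induce a nontrivial [X], and [g X] fits on
    neither side. This leaves [n] elements for [A0] and [2 ^ n] for the [g X]. *)
Lemma conn_del_bound P Q : P \subset Q -> conn f P Q ->
  (forall e, e \in Q -> e \notin P -> ~ conn f P (Q :\ e)) ->
  #|Q :\: P| <= (f Q - f P) + 2 ^ (f Q - f P).
Proof.
move=> PQ cPQ nc; have [small|big] := leqP #|Q :\: P| 1.
  by have := expn_gt0 2 (f Q - f P); nat_lia.
have loopless e : e \in Q -> e \notin P -> f P < f (e |: P).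
  move=> eQ eP; have := conn_lt PQ cPQ eQ eP big.
  have := rank_like_mono rf (subD1set Q e); nat_lia.
have flatP X : P \subset X -> X \subset Q -> f X <= f P -> X = P.
  move=> PX XQ le; apply/eqP; rewrite eqEsubset PX andbT; apply/subsetP => e eX.
  apply: contraT => eP; have := loopless e (subsetP XQ _ eX) eP.
  have : e |: P \subset X by rewrite subUset sub1set eX.
  by move/(rank_like_mono rf); nat_lia.
have [A0 [PA0 A0Q fA0 cA0]] := rank_basis PQ.
(* The conditions on [X] stand under the existential so that [choice] returns a total function. *)
have ex X : exists e, X \subset A0 -> P \subset X -> X != P -> X != A0 ->
   [/\ e \in Q, f X < f (e |: X) & f (P :|: (A0 :\: X)) < f (e |: (P :|: (A0 :\: X)))].
  apply: contrapT => /forallNP h.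
  have [e0 _] : exists e, e \in Q :\: P by apply/card_gt0P; nat_lia.
  have [XA0 [PX [XP XA]]] : X \subset A0 /\ P \subset X /\ X != P /\ X != A0.
    have /not_implyP[? /not_implyP[? /not_implyP[? /not_implyP[]]]] := h e0; by [].
  have {}h e : e \in Q -> f (e |: X) <= f X \/
      f (e |: (P :|: (A0 :\: X))) <= f (P :|: (A0 :\: X)).
    move=> eQ; have := h e; case: leqP; [by left|move=> l1].
    case: leqP; [by right|move=> l2]; case; by [].
  set Y := P :|: (A0 :\: X) in h *.
  have YQ : Y \subset Q by clear -PQ A0Q; subdec.
  have XQ : X \subset Q := subset_trans XA0 A0Q.
  have PY : P \subset Y by apply: subsetUl.
  have cXY : #|X :\: P| + #|Y :\: P| <= #|A0 :\: P|.
    have := cardsUI (X :\: P) (Y :\: P).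
    have -> : (X :\: P) :&: (Y :\: P) = set0 by rewrite /Y; clear; setdec.
    have -> : (X :\: P) :|: (Y :\: P) = A0 :\: P by rewrite /Y; clear -XA0; setdec.
    by rewrite cards0 addn0 => <-.
  have fXY : f X + f Y <= f P + f Q.
    have := rank_like_card PX; have := rank_like_card PY.
    have := rank_like_mono rf PQ; nat_lia.
  (* If no element works, the closures of [X] and [Y] in [Q] cover [Q], with the same ranks as [X]
     and [Y]. *)
  pose X' := [set e in Q | f (e |: X) <= f X]; pose Y' := [set e in Q | f (e |: Y) <= f Y].
  have in_cl Z e : e \in Z -> f (e |: Z) <= f Z.
    by move=> eZ; rewrite (setUidPr _) // sub1set.
  have XX' : X \subset X'.
    by apply/subsetP => e eX; rewrite inE (subsetP XQ) // in_cl.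
  have YY' : Y \subset Y'.
    by apply/subsetP => e eY; rewrite inE (subsetP YQ) // in_cl.
  have fX' : f X' = f X by apply: rank_like_closure => // e; rewrite inE => /andP[].
  have fY' : f Y' = f Y by apply: rank_like_closure => // e; rewrite inE => /andP[].
  have Q' : X' :|: Y' = Q.
    apply/setP => e; rewrite !inE; case: (boolP (e \in Q)) => //= /h[->|->] //.
    by rewrite orbT.
  have le : f (P :|: (Y' :\: X')) <= f Y'.
    apply: rank_like_mono => //; clear -PY YY'; clearbody X' Y' Y; subdec.
  clearbody X' Y'.
  (* The closures may overlap beyond [P], so the second one is cut down. *)
  case: (cPQ X' (P :|: (Y' :\: X'))).
  - by clear -Q' PQ; setdec.
  - by clear -PX XX'; setdec.
  - by rewrite fX'; apply: leq_trans fXY; rewrite leq_add2l -fY'.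
  - move=> e; case/eqP: XP; apply/eqP; rewrite eqEsubset PX andbT -e //.
  - move=> e; have X'Q : X' = Q by clear -e Q' PX XX'; setdec.
    have YP : Y = P by apply: flatP => //; move: fXY; rewrite -fX' X'Q; nat_lia.
    case/eqP: XA; apply/eqP; rewrite eqEsubset XA0 /=; apply/subsetP => z zA.
    have [zP|zP] := boolP (z \in P); first exact: (subsetP PX).
    by move: (mem_eq YP z); rewrite /Y !inE zA (negPf zP) andbT /= => /negbFE.
have [g hg] := choice ex.
pose T := g @: [set P :|: X | X in powerset (A0 :\: P)].
have cT : #|T| <= 2 ^ (f Q - f P).
  apply: leq_trans (leq_imset_card _ _) _; apply: leq_trans (leq_imset_card _ _) _.
  by rewrite card_powerset leq_exp2l.
have memT X : X \subset A0 -> P \subset X -> g X \in T.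
  move=> XA PX; apply/imset_f/imsetP; exists (X :\: P).
    by rewrite inE setSD.
  by clear -PX; setdec.
have [QA|] := boolP (Q \subset A0 :|: T).
  have : #|Q :\: P| <= #|(A0 :\: P) :|: T|.
    by apply: subset_leq_card; clear -QA; clearbody T; subdec.
  have := (leq_card_setU (A0 :\: P) T).1; nat_lia.
case/subsetPn => e eQ; rewrite inE => /norP[eA eT].
have eP : e \notin P by apply: contra eA; apply: (subsetP PA0).
case: (nc e eQ eP) => Z W ZW ZWP fZW.
have [_ sm] := rf.
pose X := Z :&: A0; pose Y := W :&: A0.
have A0e : A0 \subset Q :\ e by rewrite subsetD1 A0Q.
have eXY : X :|: Y = A0 by rewrite /X /Y; clear -ZW A0e; setdec.
have eXYP : X :&: Y = P by rewrite /X /Y; clear -ZWP PA0; setdec.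
have eY : Y = P :|: (A0 :\: X) by clear -eXY eXYP; setdec.
(* Here [f X + f Y >= f P + f Q >= f Z + f W], so the traces [X] and [Y] on [A0] have the ranks of
   [Z] and [W]. *)
have sXY := sm X Y; rewrite eXY eXYP fA0 in sXY.
have fX := rank_like_mono rf (subsetIl Z A0 : X \subset Z).
have fY := rank_like_mono rf (subsetIl W A0 : Y \subset W).
have fQe := rank_like_mono rf (subD1set Q e).
have ZQ : Z \subset Q by clear -ZW; subdec.
have WQ : W \subset Q by clear -ZW; subdec.
have PZ : P \subset Z by clear -ZWP; subdec.
have PW : P \subset W by clear -ZWP; subdec.
have XA : X \subset A0 := subsetIr _ _.
have PX : P \subset X by clear -eXYP; subdec.
have [XP|XP] := eqVneq X P.
  by left; apply: flatP => //; rewrite -XP; nat_lia.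
have [XA'|XA'] := eqVneq X A0.
  right; apply: flatP => //; have <- : Y = P by clear -eXYP XA' eXY; setdec.
  nat_lia.
(* [g X] is not [e], so it lies in [Z] or [W] and would give that side a larger rank than its
   trace. *)
have [gQ gX gY] := hg X XA PX XP XA'.
have gne : g X != e by apply: contraNneq eT => <-; apply: memT.
have := mem_eq ZW (g X); rewrite !inE gne gQ /= => /orP[gZ|gW].
  have : g X |: X \subset Z by rewrite subUset sub1set gZ subsetIl.
  by move/(rank_like_mono rf); nat_lia.
have : g X |: Y \subset W by rewrite subUset sub1set gW subsetIl.
by move/(rank_like_mono rf); rewrite -eY in gY; nat_lia.
Qed.

End ConnBound.

(** * Duality: deletions and contractions exchanged *)

Section Dual.
Variables (E : finType) (f : {set E} -> nat).
Hypothesis rf : rank_like f.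
Implicit Types (A B C F P Q X Y Z : {set E}).

(* The dual rank function, up to the additive constant [f setT]. *)
Definition corank X : nat := #|X| + f (~: X).

Lemma corank_rank_like : rank_like corank.
Proof.
split=> [X e|X Y]; rewrite /corank.
  have [eX|eX] := boolP (e \in X).
    by rewrite (setUidPr _) ?sub1set // leqnn leqnSn.
  have -> : ~: X = e |: ~: (e |: X) by setdec1 e isT eX.
  by rewrite cardsU1 eX; have [/(_ (~: (e |: X)) e)] := rf; lia.
have [_ /(_ (~: X) (~: Y))] := rf; rewrite -setCI -setCU; have := cardsUI X Y; lia.
Qed.

(** Complementation reverses the interval from [P] to [Q]. The excess of a separation is unchanged
    because cardinality is modular. *)
Lemma corank_conn P Q : P \subset Q -> conn corank (~: Q) (~: P) <-> conn f P Q.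
Proof.
move=> PQ; have dual A C : A :|: C = Q -> A :&: C = P ->
    corank (~: A) + corank (~: C) + (f P + f Q) =
    corank (~: Q) + corank (~: P) + (f A + f C).
  move=> AC ACP; rewrite /corank !setCK; have := cardsUI (~: A) (~: C).
  by rewrite -setCI -setCU AC ACP; lia.
split=> h A C AC ACP le.
  have := dual _ _ AC ACP => e.
  case: (h (~: A) (~: C)); rewrite -?setCI -?setCU ?AC ?ACP //; first lia.
  - by move/setC_inj => AQ; right; clear -AC ACP AQ; setdec.
  - by move/setC_inj => CQ; left; clear -AC ACP CQ; setdec.
have e1 : ~: A :|: ~: C = Q by rewrite -setCI ACP setCK.
have e2 : ~: A :&: ~: C = P by rewrite -setCU AC setCK.
have := dual _ _ e1 e2; rewrite !setCK => e.
case: (h _ _ e1 e2); first lia.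
- by move=> AP; right; clear -e1 e2 AP; setdec.
- by move=> CP; left; clear -e1 e2 CP; setdec.
Qed.

(** The dual of [conn_del_bound]; the exponent is the rank of the dual of the minor, that is, its
    nullity. *)
Lemma conn_contr_bound P Q : P \subset Q -> conn f P Q ->
  (forall e, e \in Q -> e \notin P -> ~ conn f (e |: P) Q) ->
  #|Q :\: P| <= (#|Q :\: P| + f P - f Q) + 2 ^ (#|Q :\: P| + f P - f Q).
Proof.
move=> PQ cPQ nc; set n := (_ + f P - f Q).
have c : #|~: P| = #|~: Q| + #|Q :\: P|.
  have e1 : ~: P :&: Q = Q :\: P by clear; setdec.
  have e2 : ~: P :\: Q = ~: Q by clear -PQ; setdec.
  by rewrite -(cardsID Q (~: P)) e1 e2 addnC.
have -> : n = corank (~: P) - corank (~: Q) by rewrite /corank !setCK /n; lia.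
have eD : Q :\: P = ~: P :\: ~: Q by clear; setdec.
rewrite eD.
apply: conn_del_bound; [exact: corank_rank_like|by rewrite setCS|exact/corank_conn|].
move=> e; rewrite !inE negbK => eP eQ.
have -> : ~: P :\ e = ~: (e |: P) by clear -eQ eP; setdec1 e eQ eP.
by move/corank_conn => h; apply: (nc e eQ eP); apply: h; rewrite subUset sub1set eQ.
Qed.

End Dual.

(** * Flacets and connectivity *)

Section FlacetConn.
Variables (E : finType) (M : matroid E).
Implicit Types (A B C D F X Y Z : {set E}).
Notation V := (mbases M).
Notation S := (mground M).
Notation r := (mrank M).

Lemma rank_rank_like : rank_like r.
Proof. by split=> [X e|X Y]; [exact: rank_setU1|exact: rank_submod]. Qed.

Lemma rank0 : r set0 = 0.
Proof. by apply/eqP; rewrite -leqn0 -(cards0 E) rank_le_card. Qed.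

Lemma card_setIUI B A C : #|B :&: A| + #|B :&: C| = #|B :&: (A :|: C)| + #|B :&: (A :&: C)|.
Proof. by rewrite -cardsUI -setIUr setIACA setIid. Qed.

(** If every base tight for [F] is tight for [F'], then [F'] splits [F] into [F :&: F'] and
    [F :\: F'], and splits the rest into its parts inside and outside [F'], in both cases with
    additive ranks. Connectivity makes both splits trivial. *)
Lemma conn_flacet F : F \subset S -> conn r set0 F -> conn r F S ->
  r S < r F + r (S :\: F) -> flacet M F.
Proof.
move=> FS c1 c2 lam; split=> //; first exact/tight_properP.
move=> F' F'S /tight_properP nV sF.
pose A := F :&: F'; pose A2 := F :|: F'; pose D := F :|: (S :\: F').
have tF' B : B \in tight M F -> #|B :&: F'| = r F' by move=> /(subsetP sF)/tightP[].
have sAF : A \subset F := subsetIl _ _.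
have sFA2 : F \subset A2 := subsetUl _ _.
have sFD : F \subset D := subsetUl _ _.
have [B1 [/tightP[B1V B1A] B1F /tightP[_ B1A2]]] := tight_chain3 M sAF sFA2.
have [B2 [/tightP[B2V B2A] B2F /tightP[_ B2A2]]] := tight_chain3 M (subsetDl F F') sFA2.
have [B3 [/tightP[B3V B3A] B3F /tightP[_ B3D]]] := tight_chain3 M sAF sFD.
have e1 : r A + r (F :\: F') <= r set0 + r F.
  have := tF' _ B1F; have := tF' _ B2F.
  have [_] := tightP _ _ _ B1F; have [_] := tightP _ _ _ B2F.
  have := card_setIUI B1 F F'; have := card_setIUI B2 F F'.
  have := card_setI_split B2 sAF; rewrite (_ : F :\: A = F :\: F').
    by rewrite -/A -/A2; nat_lia.
  by rewrite /A setDIr setDv set0U.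
have e2 : r A2 + r D <= r F + r S.
  have := tF' _ B1F; have := tF' _ B3F.
  have [_] := tightP _ _ _ B1F; have [_] := tightP _ _ _ B3F.
  have := card_setIUI B1 F F'; have := card_setIUI B3 F F'.
  have := card_setIUI B3 A2 D.
  have -> : A2 :|: D = S by rewrite /A2 /D; clear -FS F'S; setdec.
  have -> : A2 :&: D = F by rewrite /A2 /D; clear; setdec.
  have [_] := tightP _ _ _ (tightS B3V).
  by rewrite -/A -/A2; nat_lia.
have nF0 : F' <> set0 by move=> e; move: nV; rewrite e setD0 rank0 ltnn.
have nFS : F' <> S by move=> e; move: nV; rewrite e setDv rank0 addn0 ltnn.
(* The four cases are [F'] empty, [F' = S :\: F], [F' = F] and [F' = S]; the first and last are not
   proper faces, and the second contradicts [lam]. *)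
case: (c1 A (F :\: F') _ _ e1) => [| |A0|FF'].
- by rewrite /A; clear; setdec.
- by rewrite /A; clear; setdec.
- case: (c2 A2 D _ _ e2) => [| |A2F|DF].
  + by rewrite /A2 /D; clear -FS F'S; setdec.
  + by rewrite /A2 /D; clear; setdec.
  + by case: nF0; rewrite /A /A2 in A0 A2F; clear -A0 A2F; setdec.
  + have eF' : F' = S :\: F by rewrite /A /D in A0 DF; clear -A0 DF F'S; setdec.
    have := tF' _ B1F; have [_] := tightP _ _ _ B1F.
    have := card_base_split F B1V; rewrite -eF' in lam *; nat_lia.
- case: (c2 A2 D _ _ e2) => [| |A2F|DF].
  + by rewrite /A2 /D; clear -FS F'S; setdec.
  + by rewrite /A2 /D; clear; setdec.
  + by congr tight; rewrite /A2 in A2F; clear -FF' A2F; setdec.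
  + by case: nFS; rewrite /D in DF; clear -DF FF' F'S FS; setdec.
Qed.

(** The slacks of [A] and [C] add up to that of [F]. By maximality all three sets cut out the same
    facet, so by [flacet_eq_value] the three slacks are equal and hence 0 at every base. The
    constant [m] is 0 when [F] is split, and [r S] when [S] is split over [F]. *)
Lemma flacet_no_split F A C m : conn r set0 S -> flacet M F ->
  A \subset S -> C \subset S -> A != set0 -> C != set0 -> A != S -> C != S ->
  (forall B, B \in V -> #|B :&: A| + #|B :&: C| = m + #|B :&: F|) ->
  r A + r C <= m + r F -> False.
Proof.
move=> cS fF AS CS A0 C0 AS' CS' eAC le; have [FS nV maxF] := fF.
have proper X : X \subset S -> X != set0 -> X != S -> tight M X != V.
  move=> XS X0 XS'; apply/tight_properP; rewrite ltnNge; apply/negP => h.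
  have [| | |X0'|X0'] := cS X (S :\: X).
  - by clear -XS; setdec.
  - by clear; setdec.
  - by rewrite rank0.
  - by rewrite X0' eqxx in X0.
  - by case/eqP: XS'; clear -XS X0'; setdec.
have tA : tight M A = tight M F.
  apply: maxF (proper _ _ _ _) _ => //; apply/subsetP => B /tightP[BV BF].
  apply/tightP; split=> //; have := eAC _ BV; have := rank_ge A BV; have := rank_ge C BV.
  by clear -le BF; nat_lia.
have tC : tight M C = tight M F.
  apply: maxF (proper _ _ _ _) _ => //; apply/subsetP => B /tightP[BV BF].
  apply/tightP; split=> //; have := eAC _ BV; have := rank_ge A BV; have := rank_ge C BV.
  by clear -le BF; nat_lia.
case/eqP: nV; apply/setP => B; apply/tightP/idP => [[]//|BV]; split=> //.
have [B0 B0F] := tight_nonempty M F; have [B0V eB0F] := tightP _ _ _ B0F.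
have := B0F; rewrite -tA => /tightP[_ eB0A]; have := B0F; rewrite -tC => /tightP[_ eB0C].
have := eAC _ B0V; have := eAC _ BV.
have := flacet_eq_value fF tA BV; have := flacet_eq_value fF tC BV.
by nat_lia.
Qed.

Lemma flacet_conn F : conn r set0 S -> flacet M F -> conn r set0 F /\ conn r F S.
Proof.
move=> cS fF; have [FS nV _] := fF.
have FneS : F != S by apply: contraNneq nV => ->; apply/eqP/setP => B;
  apply/idP/idP => [/tightP[]//|]; apply: tightS.
split=> A C AC ACP le; apply: contrapT => /not_orP[nA nC].
  apply: (@flacet_no_split F A C 0) => //; rewrite ?rank0 in le *.
  - by clear -AC FS; subdec.
  - by clear -AC FS; subdec.
  - exact/eqP.
  - exact/eqP.
  - by apply/eqP => e; case: nC; rewrite e in AC ACP; clear -AC ACP FS; setdec.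
  - by apply/eqP => e; case: nA; rewrite e in AC ACP; clear -AC ACP FS; setdec.
  - move=> B BV; have := card_setIUI B A C; rewrite AC ACP setI0 cards0; nat_lia.
  - by nat_lia.
apply: (@flacet_no_split F A C (r S)) => //.
- by rewrite -AC subsetUl.
- by rewrite -AC subsetUr.
- by apply/eqP => e; case: nA; rewrite -ACP e set0I.
- by apply/eqP => e; case: nC; rewrite -ACP e setI0.
- by apply/eqP => e; case: nC; rewrite -ACP e; clear -AC; setdec.
- by apply/eqP => e; case: nA; rewrite -ACP e; clear -AC; setdec.
- move=> B BV; have := card_setIUI B A C; rewrite AC ACP.
  by have [_ ->] := tightP _ _ _ (tightS BV).
- by rewrite [r S + _]addnC.
Qed.

End FlacetConn.

(** * Minors *)

(* [K] is contracted and [Z :\: K] is deleted. *)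
Definition trace_minor (E : finType) (N M : matroid E) (Z K : {set E}) : Prop :=
  [/\ Z \subset mground M, K \subset Z, mground N = mground M :\: Z &
      mbases N = [set B :\: Z | B in [set B in mbases M | B :&: Z == K]]].

Section Minors.
Variables (E : finType).
Implicit Types (A B C D F X Y Z K : {set E}) (M N P : matroid E).

Lemma trace_minor_baseP N M Z K X : trace_minor N M Z K ->
  reflect (X :&: Z = set0 /\ X :|: K \in mbases M) (X \in mbases N).
Proof.
move=> [ZS KZ _ ->]; apply: (iffP imsetP) => [[B]|[X0 XV]].
  rewrite inE => /andP[BV /eqP BZ] ->; split; first by clear; setdec.
  by have -> : (B :\: Z) :|: K = B by rewrite -BZ; clear; setdec.
exists (X :|: K); last by clear -X0 KZ; setdec.
by rewrite inE XV; apply/eqP; clear -X0 KZ; setdec.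
Qed.

Lemma trace_minor_exists M Z B : Z \subset mground M -> B \in mbases M ->
  exists N, trace_minor N M Z (B :&: Z).
Proof.
move=> ZS BV; set K := B :&: Z.
pose W := [set B :\: Z | B in [set B in mbases M | B :&: Z == K]].
have ax : matroid_axiom (mground M :\: Z) W.
  apply/and3P; split.
  - by apply/set0Pn; exists (B :\: Z); apply: imset_f; rewrite inE BV eqxx.
  - apply/forall_inP => _ /imsetP[C + ->]; rewrite inE => /andP[CV _].
    exact/setSD/base_sub.
  apply/forall_inP => _ /imsetP[C + ->]; rewrite inE => /andP[CV /eqP CK].
  apply/forall_inP => _ /imsetP[D + ->]; rewrite inE => /andP[DV /eqP DK].
  apply/forall_inP => x; rewrite !inE => /andP[+ /andP[xZ xC]]; rewrite xZ /= => xD.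
  have [|y] := base_exchange CV DV (x := x); first by rewrite inE xD.
  rewrite inE => /andP[yC yD] XV.
  have yZ : y \notin Z.
    by apply: contra yC => yZ; have := mem_eq CK y; rewrite -DK !inE yZ yD !andbT => ->.
  apply/exists_inP; exists y; first by rewrite !inE yZ yD yC.
  apply/imsetP; exists (y |: (C :\ x)).
    rewrite inE XV; apply/eqP; rewrite -CK; apply/setP => z; rewrite !inE.
    case: (z =P y) => [->|_]; first by rewrite (negPf yZ) !andbF.
    by case: (z =P x) => [->|_] //=; rewrite (negPf xZ) !andbF.
  apply/setP => z; rewrite !inE.
  case: (z =P y) => [->|_]; first by rewrite yZ.
  by case: (z \in Z); case: (z == x).
by exists (Matroid ax); split=> //; apply: subsetIr.
Qed.

Lemma trace_minor_rank N M Z K X : trace_minor N M Z K -> X \subset mground M :\: Z ->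
  mrank N X + #|K| = mrank M (X :|: K).
Proof.
move=> tN XS; have baseN B := trace_minor_baseP B tN; have [ZS KZ gN bN] := tN.
have KX : K \subset X :|: K := subsetUr _ _.
have [C CN] := bases_nonempty N; have [CZ CKV] := baseN _ CN.
have rK : mrank M K = #|K|.
  apply/eqP; rewrite eqn_leq rank_le_card; have := rank_ge K CKV.
  by rewrite (setIidPr _) // subsetUr.
have sXK : X :|: K \subset mground M :\: (Z :\: K).
  by clear -XS KZ ZS; subdec.
have rS : mrank M (mground M :\: (Z :\: K)) = mrank M (mground M).
  apply/eqP; rewrite eqn_leq (rank_like_mono (rank_rank_like M)) ?subsetDl //.
  rewrite (rankS CKV); have := rank_ge (mground M :\: (Z :\: K)) CKV.
  rewrite (setIidPl _) //; have := base_sub CKV; clear -CZ KZ => CKS; subdec.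
(* A base tight along this chain contains [K] and avoids [Z :\: K], so it comes from a base of [N],
   and it still realizes the rank of [X :|: K]. *)
have [B [/tightP[BV BK] /tightP[_ BXK] /tightP[_ BD]]] := tight_chain3 M KX sXK.
have KB : K \subset B by apply/setIidPr/eqP; rewrite eqEcard subsetIr BK rK leqnn.
have BZK : B :&: (Z :\: K) = set0.
  have := card_base_split (Z :\: K) BV; rewrite BD rS => /eqP.
  by rewrite -{1}[mrank M _]add0n eqn_add2r eq_sym cards_eq0 => /eqP.
have BZN : B :\: Z \in mbases N.
  apply/baseN; split; first by clear; setdec.
  by have -> : B :\: Z :|: K = B by clear -BZK KB KZ; setdec.
have split Y : Y :&: Z = set0 -> #|Y :&: X| + #|K| = #|(Y :|: K) :&: (X :|: K)|.
  move=> YZ; rewrite -cardsUI -setUIl.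
  have -> : Y :&: X :&: K = set0 by clear -YZ KZ; setdec.
  by rewrite cards0 addn0.
apply/eqP; rewrite eqn_leq; apply/andP; split.
  have [D /tightP[DN <-]] := tight_nonempty N X; have [DZ DV] := baseN _ DN.
  by rewrite split // rank_ge.
have := rank_ge X BZN; rewrite -BXK -(leq_add2r #|K|) split; last by clear; setdec.
have -> : (B :\: Z) :|: K = B by clear -BZK KB KZ; setdec.
by [].
Qed.

Lemma trace_minor_by N M Z K : trace_minor N M Z K -> minor_by N M K (Z :\: K).
Proof.
move=> tN; have [ZS KZ gN bN] := tN.
have eZ : K :|: (Z :\: K) = Z by clear -KZ; setdec.
split; rewrite ?eZ //.
- exact: subset_trans ZS.
- exact: subset_trans (subsetDl _ _) ZS.
- by rewrite -setI_eq0; apply/eqP; clear; setdec.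
have [C /(trace_minor_baseP _ tN)[CZ CKV]] := bases_nonempty N.
have rK : mrank M K = #|K|.
  apply/eqP; rewrite eqn_leq rank_le_card; have := rank_ge K CKV.
  by rewrite (setIidPr _) // subsetUr.
have rS : mrank M (mground M :\: (Z :\: K)) = mrank M (mground M).
  apply/eqP; rewrite eqn_leq (rank_like_mono (rank_rank_like M)) ?subsetDl //.
  rewrite (rankS CKV); have := rank_ge (mground M :\: (Z :\: K)) CKV.
  rewrite (setIidPl _) //; have := base_sub CKV; clear -CZ KZ => CKS; subdec.
rewrite bN; set W := [set B in _ | _ && _].
suff -> : [set B in mbases M | B :&: Z == K] = W by [].
apply/setP => B; rewrite !inE; case: (boolP (B \in mbases M)) => //= BV.
rewrite rS rK (card_base_split (Z :\: K) BV).
rewrite -[X in _ = (X == _ + _) && _]add0n eqn_add2r [0 == _]eq_sym cards_eq0.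
apply/eqP/andP => [BZ|[/eqP BZK /eqP BK]].
  split; first by apply/eqP; rewrite -BZ; clear; setdec.
  by have -> : B :&: K = K by clear -BZ; setdec.
have KB : K \subset B by apply/setIidPr/eqP; rewrite eqEcard subsetIr BK leqnn.
by clear -KB KZ BZK; setdec.
Qed.

(** The bases tight for [Y] are those of the direct sum of the restriction to [Y] and the
    contraction of [Y], so the two parts recombine freely. *)
Lemma base_swap M B C Y : B \in tight M Y -> C \in tight M Y ->
  (B :&: Y) :|: (C :\: Y) \in mbases M.
Proof.
move=> /tightP[BV BY] /tightP[CV CY].
set D := _ :|: _; have rf := rank_rank_like M.
have cD : #|D| = #|C|.
  rewrite /D cardsU -(cardsID Y C) BY -CY.
  have -> : B :&: Y :&: (C :\: Y) = set0 by clear; setdec.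
  by rewrite cards0 subn0.
have rD : #|C| <= mrank M D.
  have [_ /(_ D Y)] := rf.
  have -> : D :&: Y = B :&: Y by rewrite /D; clear; setdec.
  have : #|C| <= mrank M (D :|: Y).
    apply: leq_trans (rank_ge _ CV); rewrite (setIidPl _) // /D; clear; subdec.
  have := rank_ge (B :&: Y) BV; rewrite setIA setIid BY; nat_lia.
have [B' /tightP[B'V B'D]] := tight_nonempty M D.
suff -> : D = B' by [].
have sDB : D \subset B' by apply/setIidPr/eqP; rewrite eqEcard subsetIr B'D cD.
by apply/eqP; rewrite eqEcard sDB (base_card B'V CV) cD /=.
Qed.

(** In [minor_by] the set [C] may be dependent and the bases may have to meet [D], so their traces
    on [C :|: D] vary. Two swaps, at [C] and at the complement of [D], give every admissible base
    the trace of one fixed base without changing it elsewhere. *)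
Lemma minor_by_trace N M C D : minor_by N M C D -> exists K, trace_minor N M (C :|: D) K.
Proof.
move=> [CS DS CD gN bN]; have [X XN] := bases_nonempty N.
move: (XN); rewrite bN => /imsetP[B]; rewrite !inE => /and3P[BV /eqP BD /eqP BC] _.
have CD0 : C :&: D = set0 by apply/eqP; rewrite setI_eq0.
exists (B :&: (C :|: D)); split=> //; first by rewrite subUset CS.
  exact: subsetIr.
have splitD A : A \in mbases M -> mrank M (mground M) = #|A :&: D| + #|A :&: (mground M :\: D)|.
  exact: card_base_split.
rewrite bN; apply/eqP; rewrite eqEsubset; apply/andP; split; apply/subsetP => Y.
  move=> /imsetP[A]; rewrite !inE => /and3P[AV /eqP AD /eqP AC] ->.
  have A1V : (B :&: C) :|: (A :\: C) \in mbases M by apply: base_swap; apply/tightP.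
  set A1 := _ :|: _ in A1V.
  have A1D : A1 :&: D = A :&: D by rewrite /A1; clear -CD0; setdec.
  have A2V : (A1 :&: (mground M :\: D)) :|: (B :\: (mground M :\: D)) \in mbases M.
    apply: base_swap; apply/tightP; split=> //.
    have := splitD _ A1V; rewrite A1D -AD; have := splitD _ AV; nat_lia.
  apply/imsetP; exists ((A1 :&: (mground M :\: D)) :|: (B :\: (mground M :\: D))).
    rewrite inE A2V; apply/eqP; rewrite /A1; have := base_sub BV; have := base_sub AV.
    by clear -CS DS CD0 => AS BS; setdec.
  rewrite /A1; have := base_sub BV; have := base_sub AV.
  by clear -CS DS CD0 => AS BS; setdec.
move=> /imsetP[A]; rewrite !inE => /andP[AV /eqP AZ] ->.
have AD' : A :&: D = B :&: D by clear -AZ; setdec.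
have AC' : A :&: C = B :&: C by clear -AZ; setdec.
apply: imset_f; rewrite !inE AV AC' BC eqxx andbT /=; apply/eqP.
by have := splitD _ AV; have := splitD _ BV; rewrite AD' -BD; nat_lia.
Qed.

Lemma trace_minor_trans P N M Z K Z' K' : trace_minor N M Z K -> trace_minor P N Z' K' ->
  trace_minor P M (Z :|: Z') (K :|: K').
Proof.
move=> tN tP; have [ZS KZ gN bN] := tN; have [Z'S K'Z gP bP] := tP.
split.
- by rewrite gN in Z'S; clear -ZS Z'S; subdec.
- exact: setUSS.
- by rewrite gP gN; clear; setdec.
rewrite gN in Z'S.
apply/setP => X; apply/(trace_minor_baseP _ tP)/imsetP => [[XZ /(trace_minor_baseP _ tN)[h XV]]|].
  exists (X :|: K' :|: K); last by clear -XZ h KZ K'Z Z'S; setdec.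
  by rewrite inE XV; apply/eqP; clear -XZ h KZ K'Z Z'S; setdec.
case=> B; rewrite inE => /andP[BV /eqP BZ] ->; split; first by clear; setdec.
apply/(trace_minor_baseP _ tN); split; first by clear -Z'S K'Z; setdec.
have -> // : B :\: (Z :|: Z') :|: K' :|: K = B.
by clear -BZ; setdec.
Qed.

Lemma is_minor_refl M : is_minor M M.
Proof.
exists set0, (set0 :\: set0); apply: trace_minor_by; split; rewrite ?sub0set ?setD0 //.
apply/setP => B; apply/idP/imsetP => [BV|[C + ->]].
  by exists B; rewrite ?setD0 // inE BV setI0 eqxx.
by rewrite inE setD0 => /andP[].
Qed.

Lemma is_minor_trans P N M : is_minor P N -> is_minor N M -> is_minor P M.
Proof.
move=> [C [D /minor_by_trace[K tP]]] [C' [D' /minor_by_trace[K' tN]]].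
by have t := trace_minor_by (trace_minor_trans tN tP); eexists; eexists; apply: t.
Qed.

Lemma proper_minor_card N M : is_proper_minor N M -> #|mground N| < #|mground M|.
Proof.
move=> [C [D [[CS DS _ -> _] /set0Pn[e eCD]]]]; apply/proper_card/properP; split.
  exact: subsetDl.
exists e; last by rewrite inE eCD.
by move: eCD; rewrite inE => /orP[/(subsetP CS)|/(subsetP DS)].
Qed.

Lemma trace_minor_proper N M Z K : trace_minor N M Z K -> Z != set0 -> is_proper_minor N M.
Proof.
move=> tN Z0; have [_ KZ _ _] := tN; exists K, (Z :\: K); split.
  exact: trace_minor_by.
by have -> : K :|: (Z :\: K) = Z by clear -KZ; setdec.
Qed.

Lemma affval_setU (a : {ffun E -> R}) c X K : [disjoint X & K] ->
  (affval a c (X :|: K) = affval a c X + \sum_(e in K) a e)%R.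
Proof.
move=> dXK; rewrite /affval (eq_bigl [predU X & K]) => [|e]; last by rewrite !inE.
by rewrite bigU //= addrAC.
Qed.

Lemma trace_minor_Lev N M Z K : trace_minor N M Z K -> Lev N <= Lev M.
Proof.
move=> tN; have [ZS KZ gN bN] := tN; have baseN X := trace_minor_baseP X tN.
have disj X : X \in mbases N -> [disjoint X & K].
  move=> /baseN[XZ _]; rewrite -setI_eq0; apply/eqP; clear -XZ KZ; setdec.
apply: (@Lev_face_embed _ _ M N (fun X => X :|: K)).
(* With constant term [#|K|] this function counts [K :\: B] and [B :&: (Z :\: K)], so it vanishes
   exactly when [B :&: Z = K]. *)
- pose a := [ffun e : E => if e \in K then -1 else if e \in Z then 1 else 0]%R : {ffun E -> R}.
  have va B : affval a #|K|%:R%R B = (#|K :\: B|%:R + #|B :&: (Z :\: K)|%:R)%R.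
    have cK : #|K| = #|K :\: B| + #|B :&: K| by rewrite -(cardsID B K) addnC setIC.
    have s2 (Y : {set E}) :
        (#|B :&: Y|%:R = \sum_(e in B) (if e \in Y then 1 else 0) :> R)%R.
      by rewrite -big_mkcondr -sum1_card natr_sum; apply: eq_bigl => e; rewrite inE.
    have sa : (\sum_(e in B) a e = #|B :&: (Z :\: K)|%:R - #|B :&: K|%:R)%R.
      rewrite !s2 -sumrB; apply: eq_bigr => e _; rewrite ffunE !inE.
      by case: (e \in K) => /=; rewrite ?subr0 ?sub0r.
    by rewrite /affval sa cK natrD; lra.
  exists a, #|K|%:R%R; split.
    by move=> B _; rewrite va addr_ge0 ?ler0n.
  apply/setP => B; apply/imsetP/face_ofP => [[X /baseN[XZ XV] ->]|[BV]].
    split=> //; rewrite va.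
    have -> : K :\: (X :|: K) = set0 by clear; setdec.
    have -> : (X :|: K) :&: (Z :\: K) = set0 by clear -XZ; setdec.
    by rewrite cards0 addr0.
  rewrite va -natrD => /eqP; rewrite pnatr_eq0 addn_eq0 !cards_eq0.
  move=> /andP[/eqP KB /eqP BZK].
  have eB : B = (B :\: Z) :|: K by clear -KB BZK KZ; setdec.
  exists (B :\: Z) => //; apply/baseN; rewrite -eB; split=> //.
  by clear; setdec.
- move=> a c; exists a, (c + \sum_(e in K) a e)%R => X XN.
  by rewrite affval_setU ?disj // /affval addrA.
- move=> a c; exists [ffun e => if e \in Z then 0 else a e]%R, c => X XN.
  have [XZ _] := baseN _ XN; rewrite affval_setU ?disj // [X in (_ + X)%R]big1.
    rewrite addr0 /affval; congr (_ + _)%R; apply: eq_bigr => e eX; rewrite ffunE.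
    by move: (mem_eq XZ e); rewrite !inE eX /= => ->.
  by move=> e eK; rewrite ffunE (subsetP KZ).
Qed.

End Minors.

(** * Minimal matroids *)

Section ConnTransfer.
Variables (E : finType) (f : {set E} -> nat).
Hypothesis rf : rank_like f.
Implicit Types (A B C F P Q X Y Z : {set E}).

(** Each set containing [P :\ e] already spans [e], so the contraction of [P] is the same minor
    after [e] is deleted. *)
Lemma conn_del_spanned P Q e : e \in P -> P \subset Q -> f (P :\ e) = f P ->
  conn f P Q -> conn f (P :\ e) (Q :\ e).
Proof.
move=> eP PQ fP cPQ A C AC ACP le.
have eQ := subsetP PQ e eP; have [_ sm] := rf.
have add X : P :\ e \subset X -> e \notin X -> f (e |: X) <= f X.
  move=> PX eX; have := sm X P.
  have -> : X :|: P = e |: X by clear -PX eP eX; setdec1 e eP eX.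
  have -> : X :&: P = P :\ e by clear -PX eP eX; setdec1 e eP eX.
  nat_lia.
have PA : P :\ e \subset A by rewrite -ACP subsetIl.
have PC : P :\ e \subset C by rewrite -ACP subsetIr.
have eA : e \notin A by move: (mem_eq AC e); rewrite !inE eqxx /=; case: (e \in A).
have eC : e \notin C by move: (mem_eq AC e); rewrite !inE eqxx /= orbC; case: (e \in C).
have back X : e \notin X -> e |: X = P -> X = P :\ e.
  by move=> eX <-; rewrite setU1K.
case: (cPQ (e |: A) (e |: C)).
- by rewrite -setUUr AC setD1K.
- by rewrite -setUIr ACP setD1K.
- have := add _ PA eA; have := add _ PC eC; have := rank_like_mono rf (subD1set Q e).
  by nat_lia.
- by move=> h; left; apply: back.
- by move=> h; right; apply: back.
Qed.

(** As a coloop of [e |: Q], the element [e] adds exactly one to the rank of each subset of [Q], so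
    contracting it leaves the minor on [Q] unchanged. *)
Lemma conn_contr_free P Q e : e \notin Q -> P \subset Q -> f (e |: Q) = (f Q).+1 ->
  conn f P Q -> conn f (e |: P) (e |: Q).
Proof.
move=> eQ PQ fQ cPQ A C AC ACP le.
have eP : e \notin P by apply: contra eQ; apply: (subsetP PQ).
have [st sm] := rf.
have eA : e \in A by move: (mem_eq ACP e); rewrite !inE eqxx /=; case: (e \in A).
have eC : e \in C by move: (mem_eq ACP e); rewrite !inE eqxx /= andbC; case: (e \in C).
have rem X : e \in X -> X \subset e |: Q -> f (X :\ e) < f X.
  move=> eX XQ; have := sm X Q.
  have -> : X :|: Q = e |: Q by clear -XQ eX eQ; setdec1 e eX eQ.
  have -> : X :&: Q = X :\ e by clear -XQ eX eQ; setdec1 e eX eQ.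
  nat_lia.
have AQ : A \subset e |: Q by rewrite -AC subsetUl.
have CQ : C \subset e |: Q by rewrite -AC subsetUr.
have back X : e \in X -> X :\ e = P -> X = e |: P by move=> eX <-; rewrite setD1K.
case: (cPQ (A :\ e) (C :\ e)).
- by rewrite -setDUl AC setU1K.
- by rewrite -setDIl ACP setU1K.
- have := rem _ eA AQ; have := rem _ eC CQ; have /andP[_] := st P e.
  by nat_lia.
- by move=> h; left; apply: back.
- by move=> h; right; apply: back.
Qed.

Lemma rank_like_free X : (forall e, e \in X -> f (X :\ e) < f X) -> #|X| <= f X.
Proof.
move=> h; have [A [_ AX fA cA]] := rank_basis rf (sub0set X).
have [XA|] := boolP (X \subset A).
  by have := subset_leq_card XA; rewrite setD0 in cA; nat_lia.
case/subsetPn => e eX eA; have : A \subset X :\ e by rewrite subsetD1 AX.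
by move/(rank_like_mono rf); have := h e eX; nat_lia.
Qed.

End ConnTransfer.

Section ConnMinors.
Variables (E : finType).
Implicit Types (A B C D F P Q X Y Z K : {set E}) (M N : matroid E).

Lemma conn_trace_minor N M Z K P Q : trace_minor N M Z K -> Q \subset mground N ->
  conn (mrank M) (P :|: K) (Q :|: K) -> conn (mrank N) P Q.
Proof.
move=> tN QN cPQ A C AC ACP le; have [ZS KZ gN bN] := tN; rewrite gN in QN.
have rN X : X \subset Q -> mrank N X + #|K| = mrank M (X :|: K).
  by move=> XQ; apply: trace_minor_rank tN _; apply: subset_trans QN.
have AQ : A \subset Q by rewrite -AC subsetUl.
have CQ : C \subset Q by rewrite -AC subsetUr.
have PQ : P \subset Q by rewrite -ACP (subset_trans (subsetIl _ _)).
have back X : X \subset Q -> X :|: K = P :|: K -> X = P.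
  by clear -QN KZ PQ => XQ h; setdec.
case: (cPQ (A :|: K) (C :|: K)).
- by rewrite setUACA setUid AC.
- by rewrite -setUIl ACP.
- by have := rN _ AQ; have := rN _ CQ; have := rN _ PQ; have := rN _ (subxx Q); nat_lia.
- by move/(back _ AQ); left.
- by move/(back _ CQ); right.
Qed.

Lemma del_minor M e : e \in mground M -> mrank M (mground M :\ e) = mrank M (mground M) ->
  exists N, trace_minor N M [set e] set0.
Proof.
move=> eS re; have [B /tightP[BV eB]] := tight_nonempty M (mground M :\ e).
have sB : B \subset mground M :\ e.
  by apply/setIidPl/eqP; rewrite eqEcard subsetIl eB re (rankS BV) leqnn.
have [|N tN] := trace_minor_exists (Z := [set e]) _ BV; first by rewrite sub1set.
exists N; have <- // : B :&: [set e] = set0.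
by clear -sB; setdec.
Qed.

Lemma contr_minor M e : e \in mground M -> 0 < mrank M [set e] ->
  exists N, trace_minor N M [set e] [set e].
Proof.
move=> eS re; have [B /tightP[BV eB]] := tight_nonempty M [set e].
have [|N tN] := trace_minor_exists (Z := [set e]) _ BV; first by rewrite sub1set.
exists N; have eK : B :&: [set e] = [set e].
  by apply/eqP; rewrite eqEcard subsetIr cards1 eB.
by rewrite eK in tN.
Qed.

End ConnMinors.

Section Minimal.
Variables (E : finType) (M : matroid E) (k : nat).
Hypotheses (k1 : 1 < k) (hmin : forall N, is_proper_minor N M -> Lev N < k).
Implicit Types (A B C D F P Q X Y Z K : {set E}) (N : matroid E).
Notation V := (mbases M).
Notation S := (mground M).
Notation r := (mrank M).

(** If a direct summand [A] already carries the facet, then [F :&: A] is a flacet of the minor on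
    [A] with the same [lambda], so this proper minor would have levelness at least [k]. *)
Lemma component_absurd F A C : k <= Lev M -> flacet M F ->
  r S + k <= (r F + r (S :\: F)).+1 ->
  A :|: C = S -> A :&: C = set0 -> r A + r C <= r S -> C != set0 ->
  tight M (F :&: A) = tight M F -> False.
Proof.
move=> kL fF lamF AC AC0 rAC C0; set G := F :&: A => tG; have [FS nV maxF] := fF.
have rf := rank_rank_like M; have [_ sm] := rf.
have eA : S :\: C = A by clear -AC AC0; setdec.
have eC : S :\: A = C by clear -AC AC0; setdec.
have GA : G \subset A by apply: subsetIr.
(* Equal facets have equal slacks, in particular equal maximal slacks, which are [lambda F] and
   [lambda G]. *)
have lamG : r S + k <= (r G + r (S :\: G)).+1.
  have [B /tightP[BV BF]] := tight_nonempty M (S :\: F).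
  have := flacet_eq_value fF tG BV; have := card_base_split F BV.
  have := card_base_split G BV; have := rank_ge (S :\: G) BV; nat_lia.
have cA B : B \in V -> B \in tight M A.
  move=> BV; apply/tightP; split=> //; have := card_base_split A BV; rewrite eC.
  have := rank_ge A BV; have := rank_ge C BV; nat_lia.
have [B0 B0V] := bases_nonempty M; set K := B0 :&: C.
have K0 : B0 :\: A = K.
  by have B0S := base_sub B0V; rewrite /K; clear -B0S AC AC0; setdec.
have swap B : B \in V -> (B :&: A) :|: K \in V.
  by move=> BV; rewrite -K0; apply: base_swap; apply: cA.
have CS : C \subset S by rewrite -AC subsetUr.
have [N tN] := trace_minor_exists CS B0V; rewrite -/K in tN.
have [_ KC gN bN] := tN; rewrite eA in gN.
have KA X : X \subset A -> X :&: K = set0 by clear -KC AC0 => XA; setdec.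
have rN X : X \subset A -> mrank N X = r X.
  move=> XA; have := trace_minor_rank tN; rewrite eA => /(_ _ XA) e.
  have := sm X K; have := rank_le_card M K.
  have [B /tightP[BV BX]] := tight_nonempty M X.
  have := rank_ge (X :|: K) (swap _ BV).
  have -> : (B :&: A :|: K) :&: (X :|: K) = (B :&: X) :|: K.
    by clear -XA KC AC0; setdec.
  have XK0 : B :&: X :&: K = set0 by rewrite -setIA KA ?setI0.
  rewrite cardsU XK0 cards0 KA // rank0 BX; nat_lia.
have tNM X Y : Y \subset A -> X \in mbases N ->
    (X \in tight N Y) = (X :|: K \in tight M Y).
  move=> YA XN; have [XC XKV] := trace_minor_baseP _ tN XN.
  rewrite !inE XN XKV rN // setIUl.
  have -> : K :&: Y = set0 by rewrite setIC KA.
  by rewrite setU0.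
have KtM B Y : Y \subset A -> B \in V -> (B :&: A :|: K \in tight M Y) = (B \in tight M Y).
  move=> YA BV; rewrite !inE swap // BV /=.
  by have -> // : (B :&: A :|: K) :&: Y = B :&: Y by clear -YA KC AC0; setdec.
have AN B : B \in V -> B :&: A \in mbases N.
  move=> BV; apply/(trace_minor_baseP _ tN); rewrite swap //; split=> //.
  by clear -AC0; setdec.
have NV X : X \in mbases N -> X :|: K \in V by move=> /(trace_minor_baseP _ tN)[].
have sAC : r (S :\: G) <= r (A :\: G) + r C.
  have := sm (A :\: G) C; have -> : A :\: G :|: C = S :\: G.
    by clear -GA AC AC0; setdec.
  by nat_lia.
have properN Y : Y \subset A -> (tight N Y != mbases N) = (tight M Y != V).
  move=> YA; congr negb; apply/eqP/eqP => /setP h; apply/setP => X.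
    apply/idP/idP => [/tightP[]//|XV]; rewrite -KtM // -tNM ?AN //.
    by rewrite h AN.
  by apply/idP/idP => [/tightP[]//|XN]; rewrite tNM // h NV.
have fN : flacet N G.
  split; [by rewrite gN|by rewrite properN // tG|].
  rewrite gN => F' F'A; rewrite properN // => nV' sGF'.
  have tF' : tight M F' = tight M F.
    apply: maxF => //; first by apply: subset_trans F'A _; rewrite -AC subsetUl.
    rewrite -tG; apply/subsetP => B BT; have [BV _] := tightP _ _ _ BT.
    rewrite -KtM // -tNM ?AN //; apply: (subsetP sGF').
    by rewrite tNM ?AN // KtM.
  apply/setP => X; apply/idP/idP => XT; have [XN _] := tightP _ _ _ XT.
    by rewrite tNM // tG -tF' -tNM.
  by rewrite tNM // tF' -tG -tNM.
have LN : Lev N < k by apply: hmin; apply: trace_minor_proper tN C0.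
have := flacet_Lev fN; rewrite gN !rN ?subsetDl //; nat_lia.
Qed.

(** In a direct sum the slack of [F] is the sum of those of [F :&: A] and [F :&: C]. One of these
    sets cuts out a proper face, which equals the facet by maximality, and [component_absurd]
    applies to its side. *)
Lemma minimal_conn : k <= Lev M -> conn r set0 S.
Proof.
move=> kL A C AC AC0; rewrite rank0 add0n => rAC; apply: contrapT => /not_orP[/eqP A0 /eqP C0].
have [F fF lamF] := Lev_flacet k1 kL; have [FS nV maxF] := fF.
have AS : A \subset S by rewrite -AC subsetUl.
have CS : C \subset S by rewrite -AC subsetUr.
have splitF B : #|B :&: F| = #|B :&: (F :&: A)| + #|B :&: (F :&: C)|.
  rewrite (card_setI_split B (subsetIl F A)).
  by have -> : F :\: (F :&: A) = F :&: C by clear -FS AC AC0; setdec.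
have le : r (F :&: A) + r (F :&: C) <= r F.
  have cA B : B \in V -> B \in tight M A.
    move=> BV; apply/tightP; split=> //; have := card_base_split A BV.
    have -> : S :\: A = C by clear -AC AC0; setdec.
    have := rank_ge A BV; have := rank_ge C BV; nat_lia.
  have [B1 /tightP[B1V B1A]] := tight_nonempty M (F :&: A).
  have [B2 /tightP[B2V B2C]] := tight_nonempty M (F :&: C).
  have := rank_ge F (base_swap (cA _ B1V) (cA _ B2V)); rewrite splitF -B1A -B2C.
  set D := _ :|: _.
  have -> : D :&: (F :&: A) = B1 :&: (F :&: A) by rewrite /D; clear; setdec.
  have -> // : D :&: (F :&: C) = B2 :&: (F :&: C).
  by rewrite /D; clear -AC0; setdec.
have tA : tight M F \subset tight M (F :&: A).
  apply/subsetP => B /tightP[BV BF]; apply/tightP; split=> //.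
  by have := splitF B; have := rank_ge (F :&: A) BV; have := rank_ge (F :&: C) BV; nat_lia.
have tC : tight M F \subset tight M (F :&: C).
  apply/subsetP => B /tightP[BV BF]; apply/tightP; split=> //.
  by have := splitF B; have := rank_ge (F :&: A) BV; have := rank_ge (F :&: C) BV; nat_lia.
have FAS X : F :&: X \subset S by apply: subset_trans FS; apply: subsetIl.
have [eA|nA] := eqVneq (tight M (F :&: A)) V; last first.
  by apply: (component_absurd kL fF lamF AC AC0 rAC C0); apply: maxF.
have [eC|nC] := eqVneq (tight M (F :&: C)) V; last first.
  rewrite setUC in AC; rewrite setIC in AC0; rewrite addnC in rAC.
  by apply: (component_absurd kL fF lamF AC AC0 rAC A0); apply: maxF.
case/eqP: nV; apply/setP => B; apply/tightP/idP => [[]//|BV]; split=> //.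
have value X : X \in V -> #|X :&: F| = r (F :&: A) + r (F :&: C).
  move=> XV; have := XV; rewrite -{1}eA => /tightP[_ <-].
  by have := XV; rewrite -{1}eC => /tightP[_ <-].
have [B0 /tightP[B0V <-]] := tight_nonempty M F.
by rewrite !value.
Qed.

Lemma minor_conn_bound N F : is_proper_minor N M -> F \subset mground N ->
  conn (mrank N) set0 F -> conn (mrank N) F (mground N) ->
  (mrank N F + mrank N (mground N :\: F)).+1 < mrank N (mground N) + k.
Proof.
move=> pN FN c1 c2; have [small|big] := leqP (mrank N F + mrank N (mground N :\: F))
  (mrank N (mground N)); first by nat_lia.
by have := flacet_Lev (conn_flacet FN c1 c2 big); have := hmin pN; nat_lia.
Qed.

(** * Sizes of a flacet and of its complement *)

Section Bound.
Variable F : {set E}.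
Hypotheses (cM : conn r set0 S) (FS : F \subset S) (c1 : conn r set0 F) (c2 : conn r F S)
  (lamF : r S + k <= (r F + r (S :\: F)).+1).

Lemma proper_minor1 N e K : trace_minor N M [set e] K -> is_proper_minor N M.
Proof. by move/trace_minor_proper; apply; apply/set0Pn; exists e; rewrite inE. Qed.

Lemma rank_conn_del : 1 < #|S| -> forall e, e \in S -> r (S :\ e) = r S /\ 0 < r [set e].
Proof.
move=> S1 e eS; have := conn_lt (sub0set S) cM eS; rewrite inE setD0 => /(_ isT S1).
rewrite setU0 rank0; have := rank_like_mono (rank_rank_like M) (subD1set S e).
by have := rank_le_card M [set e]; rewrite cards1; nat_lia.
Qed.

Lemma inside_bound :
  r S + k = (r F + r (S :\: F)).+1 /\ #|F| <= k + 2 ^ k.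
Proof.
have rf := rank_rank_like M; have [st sm] := rf.
have p2 := expn_gt0 2 k; have SF := rank_like_mono rf (subsetDl S F).
(* Here [lambda F <= r F <= 1 <= k - 1], so equality holds already. *)
have [F1|F1] := leqP #|F| 1.
  have := rank_le_card M F; split; nat_lia.
have S1 : 1 < #|S| := leq_trans F1 (subset_leq_card FS).
have main e : e \in F ->
    [/\ ~ conn r set0 (F :\ e), r (e |: (S :\: F)) <= r (S :\: F) &
        r S + k = (r F + r (S :\: F)).+1].
  move=> eF; have eS := subsetP FS e eF; have [rSe re] := rank_conn_del S1 eS.
  have rFe : r (F :\ e) = r F.
    have := conn_lt (sub0set F) c1 eF; rewrite inE setD0 setU0 rank0 => /(_ isT F1).
    have := rank_like_mono rf (subD1set F e).
    by have := rank_le_card M [set e]; rewrite cards1; nat_lia.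
  have FeS : F :\ e \subset S :\ e by apply: setSD.
  have eSF : (S :\ e) :\: (F :\ e) = S :\: F by clear -eF eS; setdec1 e eF eS.
  have del : ~ conn r set0 (F :\ e).
    move=> c1'; have [N tN] := del_minor eS rSe; have [_ _ gN _] := tN.
    have rN X : X \subset S :\ e -> mrank N X = r X.
      by move=> XS; have := trace_minor_rank tN XS; rewrite cards0 addn0 setU0.
    have := minor_conn_bound (proper_minor1 tN) (F := F :\ e).
    rewrite gN => /(_ FeS); rewrite eSF !rN //; last by rewrite -eSF subsetDl.
    rewrite rFe rSe => h.
    have : (r F + r (S :\: F)).+1 < r S + k; last by nat_lia.
    apply: h; apply: conn_trace_minor tN _ _; rewrite ?gN // !setU0 //.
    exact: conn_del_spanned.
  have [//|c1'] := conn_step rf (sub0set F) c1 eF ltac:(by rewrite inE).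
  have [N tN] := contr_minor eS re; have [_ _ gN _] := tN.
  have rN X : X \subset S :\ e -> (mrank N X).+1 = r (e |: X).
    by move=> XS; have := trace_minor_rank tN XS; rewrite cards1 addn1 setUC.
  have := minor_conn_bound (proper_minor1 tN) (F := F :\ e).
  rewrite gN => /(_ FeS); rewrite eSF => h.
  have := rN _ FeS; have := rN _ (subxx _).
  have := rN (S :\: F); rewrite -{1}eSF subsetDl => /(_ isT).
  rewrite !setD1K // => e1 e2 e3.
  (* In terms of [M] this says [r F + r (e |: (S :\: F)) < r S + k]. Together with [lamF] it forces
     [lambda F = k - 1] and also that [S :\: F] spans [e]. *)
  have lt : (mrank N (F :\ e) + mrank N (S :\: F)).+1 < mrank N (S :\ e) + k.
    apply: h; apply: conn_trace_minor tN _ _; rewrite ?gN //.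
      by rewrite ![_ :|: [set e]]setUC setD1K.
    by rewrite ![_ :|: [set e]]setUC !setD1K.
  have /andP[ge _] := st (S :\: F) e.
  by split=> //; nat_lia.
have [e0 e0F] : exists e, e \in F by apply/card_gt0P; nat_lia.
have [_ _ eq] := main _ e0F; split=> //.
(* The complement spans all of [F], so [lambda F] is [r F], and therefore [r F = k - 1]. *)
have eS : r S = r (S :\: F).
  apply: rank_like_closure => // [|e eS]; first exact: subsetDl.
  have [eF|eF] := boolP (e \in F); first by have [] := main _ eF.
  by rewrite (setUidPr _) // sub1set inE eF.
have := conn_del_bound rf (sub0set F) c1 (fun e eF _ => let: And3 h _ _ := main e eF in h).
rewrite rank0 subn0 setD0 => h; apply: leq_trans h _.
have rFk : r F <= k by nat_lia.
by apply: leq_add => //; rewrite leq_exp2l.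
Qed.

(** Dually to [inside_bound], contracting [e] outside [F] would keep [lambda], so the deletion is
    connected, and minimality makes [e] a coloop of the restriction to [S :\: F]. *)
Lemma outside_bound : #|S :\: F| <= k + 2 ^ k.
Proof.
have rf := rank_rank_like M; have [st sm] := rf.
have [eqF _] := inside_bound.
have p2 := expn_gt0 2 k.
have [F1|F1] := leqP #|S :\: F| 1; first by nat_lia.
have S1 : 1 < #|S| := leq_trans F1 (subset_leq_card (subsetDl S F)).
have main e : e \in S :\: F ->
    ~ conn r (e |: F) S /\ r ((S :\: F) :\ e) < r (S :\: F).
  rewrite inE => /andP[eF eS]; have [rSe re] := rank_conn_del S1 eS.
  have rFe : r (e |: F) = (r F).+1.
    have := conn_lt FS c2 eS eF F1; have /andP[_] := st F e; nat_lia.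
  have FSe : F \subset S :\ e by rewrite subsetD1 FS.
  have eSF : (S :\ e) :\: F = (S :\: F) :\ e by clear; setdec.
  have contr : ~ conn r (e |: F) S.
    move=> c2'; have [N tN] := contr_minor eS re; have [_ _ gN _] := tN.
    have rN X : X \subset S :\ e -> (mrank N X).+1 = r (e |: X).
      by move=> XS; have := trace_minor_rank tN XS; rewrite cards1 addn1 setUC.
    have := minor_conn_bound (proper_minor1 tN) (F := F).
    rewrite gN => /(_ FSe); rewrite eSF => h.
    have := rN _ FSe; have := rN _ (subxx _).
    have := rN ((S :\: F) :\ e); rewrite -{1}eSF subsetDl => /(_ isT).
    rewrite !setD1K ?inE ?eF // => e1 e2 e3.
    have lt : (mrank N F + mrank N ((S :\: F) :\ e)).+1 < mrank N (S :\ e) + k.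
      apply: h; apply: conn_trace_minor tN _ _; rewrite ?gN // [_ :|: [set e]]setUC.
        by rewrite [F :|: _]setUC; apply: conn_contr_free => //; apply: sub0set.
      by rewrite [_ :\ e :|: [set e]]setUC setD1K.
    by nat_lia.
  split=> //.
  have [c2'|//] := conn_step rf FS c2 eS eF.
  have [N tN] := del_minor eS rSe; have [_ _ gN _] := tN.
  have rN X : X \subset S :\ e -> mrank N X = r X.
    by move=> XS; have := trace_minor_rank tN XS; rewrite cards0 addn0 setU0.
  have := minor_conn_bound (proper_minor1 tN) (F := F).
  rewrite gN => /(_ FSe); rewrite eSF !rN //; last by rewrite -eSF subsetDl.
  rewrite rSe => h.
  have : (r F + r (S :\: F :\ e)).+1 < r S + k.
    by apply: h; apply: conn_trace_minor tN _ _; rewrite ?gN // !setU0.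
  by nat_lia.
(* So [S :\: F] is independent, and the nullity of the contraction of [F] equals [lambda F]. *)
have free := rank_like_free rf (fun e eSF => proj2 (main e eSF)).
have := conn_contr_bound rf FS c2
  (fun e eS eF => proj1 (main e ltac:(by rewrite inE eF))).
set n := _ + r F - r S => h; apply: leq_trans h _.
have nk : n <= k by rewrite /n; nat_lia.
by apply: leq_add => //; rewrite leq_exp2l.
Qed.

End Bound.

Lemma minimal_Lev_card : k <= Lev M -> Lev M = k /\ #|S| <= 2 * (k + 2 ^ k).
Proof.
move=> kL; have cM := minimal_conn kL.
(* Used at [j = Lev M]: some flacet has [lambda] at least [j - 1], whereas [inside_bound] at [k]
   gives [lambda = k - 1], so levelness does not jump past [k]. *)
have main j : 1 < j -> k <= j -> j <= Lev M -> j = k /\ #|S| <= 2 * (k + 2 ^ k).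
  move=> j1 kj jL; have [F fF lamj] := Lev_flacet j1 jL.
  have [c1 c2] := flacet_conn cM fF; have [FS _ _] := fF.
  have lamF : r S + k <= (r F + r (S :\: F)).+1 by nat_lia.
  have [eq b1] := inside_bound cM FS c1 c2 lamF.
  have b2 := outside_bound cM FS c1 c2 lamF.
  split; first by nat_lia.
  by have := cardsID F S; rewrite (setIidPr FS); nat_lia.
by apply: main => //; apply: leq_trans kL.
Qed.

End Minimal.

(** * Isomorphism and the excluded minors *)

Lemma is_minor_Lev (E : finType) (N M : matroid E) : is_minor N M -> Lev N <= Lev M.
Proof. by move=> [C [D /minor_by_trace[K /trace_minor_Lev]]]. Qed.

Lemma exists_minimal_minor (E : finType) (M : matroid E) k : 1 < k -> k <= Lev M ->
  exists N, is_minor N M /\ minimally_level k N.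
Proof.
move=> k1; have [n] := ubnP #|mground M|; elim: n M => // n IH M ltn kL.
have [hmin|] := pselect (forall N, is_proper_minor N M -> Lev N < k).
  have [LM _] := minimal_Lev_card k1 hmin kL.
  by exists M; split; [exact: is_minor_refl|split; rewrite LM].
move=> /existsNP[N /not_implyP[pN /negP]]; rewrite -leqNgt => kN.
have [|P [PN mP]] := IH N _ kN; first exact: leq_trans (proper_minor_card pN) _.
exists P; split=> //; apply: is_minor_trans PN _.
by have [C [D [h _]]] := pN; exists C, D.
Qed.

Section Iso.
Variables (E E' : finType) (M : matroid E) (f : E -> E').
Hypothesis f_inj : {in mground M &, injective f}.
Implicit Types (B C X : {set E}).
Notation S := (mground M).

Lemma preim_imset_ground B : B \subset S -> S :&: f @^-1: (f @: B) = B.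
Proof.
move=> BS; apply/setP => z; rewrite !inE; apply/andP/idP => [[zS /imsetP[y yB /f_inj->//]]|zB].
  exact: (subsetP BS).
by rewrite (subsetP BS) // imset_f.
Qed.

Lemma affval_imset (a' : {ffun E' -> R}) c B : B \subset S ->
  affval a' c (f @: B) = affval [ffun e => a' (f e)] c B.
Proof.
move=> BS; rewrite /affval big_imset /=; last first.
  by move=> x y xB yB; apply: f_inj; apply: (subsetP BS).
by congr (_ + _)%R; apply: eq_bigr => e _; rewrite ffunE.
Qed.

Lemma affval_push (a : {ffun E -> R}) c : exists a' : {ffun E' -> R},
  forall B, B \subset S -> affval a' c (f @: B) = affval a c B.
Proof.
exists [ffun e' => \sum_(e in S | f e == e') a e]%R => B BS.
rewrite affval_imset // /affval; congr (_ + _)%R; apply: eq_bigr => e eB; rewrite !ffunE.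
have eS := subsetP BS e eB; rewrite (big_pred1 e) // => x /=.
by apply/andP/eqP => [[xS /eqP/f_inj->//]|->]; rewrite ?eqxx.
Qed.

Lemma image_matroid : exists N : matroid E', matroid_iso M N.
Proof.
have ax : matroid_axiom (f @: S) [set f @: X | X : {set E} in mbases M].
  apply/and3P; split.
  - have [B BV] := bases_nonempty M; apply/set0Pn; exists (f @: B); exact: imset_f.
  - by apply/forall_inP => _ /imsetP[B BV ->]; apply: imsetS; apply: base_sub.
  apply/forall_inP => _ /imsetP[B BV ->]; apply/forall_inP => _ /imsetP[C CV ->].
  apply/forall_inP => _ /setDP[/imsetP[x xB ->] fxC].
  have [|y] := base_exchange BV CV (x := x).
    by rewrite inE xB andbT; apply: contra fxC; apply: imset_f.
  rewrite inE => /andP[yB yC] DV; have yS := subsetP (base_sub CV) y yC.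
  have BS := subsetP (base_sub BV).
  apply/exists_inP; exists (f y).
    rewrite inE (imset_f f yC) andbT; apply: contra yB => /imsetP[z zB e].
    by rewrite (f_inj yS (BS z zB) e).
  apply/imsetP; exists (y |: (B :\ x)) => //.
  rewrite imsetU1; congr (_ |: _); apply/setP => w; apply/idP/imsetP.
    rewrite !inE => /andP[wx /imsetP[z zB e]]; exists z => //; rewrite !inE zB andbT.
    by apply: contraNneq wx => <-; rewrite e.
  move=> [z]; rewrite !inE => /andP[zx zB] ->; rewrite (imset_f f zB) andbT.
  by apply: contraNneq zx => /(f_inj (BS z zB) (BS x xB)) ->.
by exists (Matroid ax), f; split.
Qed.

End Iso.

Lemma matroid_iso_Lev (E E' : finType) (M : matroid E) (N : matroid E') :
  matroid_iso M N -> Lev M = Lev N.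
Proof.
move=> [f [f_inj _ bN]].
(* The polytope is a face of itself, cut out by the zero function, so both directions of an
   isomorphism are face embeddings. *)
have whole (E1 : finType) (M1 : matroid E1) W : W = mbases M1 -> is_face M1 W.
  move=> ->; have val0 X : affval [ffun _ : E1 => 0%R : R] 0%R X = 0%R.
    by rewrite /affval big1 ?addr0 // => e _; rewrite ffunE.
  exists [ffun _ => 0%R], 0%R; split=> [X _|]; first by rewrite val0.
  by apply/setP => X; rewrite inE val0 eqxx andbT.
apply/eqP; rewrite eqn_leq; apply/andP; split.
  apply: (@Lev_face_embed _ _ N M (fun B => f @: B)).
  - by apply: whole.
  - move=> a' c; exists [ffun e => a' (f e)], c => B BV.
    by rewrite (affval_imset f_inj) ?base_sub.
  - move=> a c; have [a' h] := affval_push f_inj a c; exists a', c => B BV.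
    by rewrite h ?base_sub.
apply: (@Lev_face_embed _ _ M N (fun X => mground M :&: f @^-1: X)).
- apply: whole; apply/setP => B; apply/imsetP/idP => [[X]|BV].
    by rewrite bN => /imsetP[C CV ->] ->; rewrite (preim_imset_ground f_inj) ?base_sub.
  exists (f @: B); first by rewrite bN imset_f.
  by rewrite (preim_imset_ground f_inj) ?base_sub.
- move=> a c; have [a' h] := affval_push f_inj a c; exists a', c => X.
  rewrite bN => /imsetP[B BV ->].
  by rewrite (preim_imset_ground f_inj) ?h ?base_sub.
- move=> a' c; exists [ffun e => a' (f e)], c => X.
  rewrite bN => /imsetP[B BV ->].
  by rewrite (preim_imset_ground f_inj) ?(affval_imset f_inj) ?base_sub.
Qed.

Lemma iso_ordinal (E : finType) (M : matroid E) m : #|mground M| <= m.+1 ->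
  exists N : matroid 'I_m.+1, matroid_iso M N.
Proof.
move=> le; pose f (e : E) : 'I_m.+1 := inord (index e (enum (mground M))).
apply: (@image_matroid _ _ M f) => x y xS yS /(congr1 val) /=.
have lt z : z \in mground M -> index z (enum (mground M)) < m.+1.
  by move=> zS; apply: leq_trans le; rewrite cardE index_mem mem_enum.
rewrite !inordK ?lt // => e.
have nthK z : z \in mground M -> nth x (enum (mground M)) (index z (enum (mground M))) = z.
  by move=> zS; rewrite nth_index ?mem_enum.
by rewrite -(nthK x xS) e nthK.
Qed.

(** The enumeration runs over the pairs that satisfy the axiom, which form a finite type; the proof
    field of the record is unique since the axiom is Boolean. *)
Lemma matroids_enumerable m (P : pred (matroid 'I_m)) :
  exists (n : nat) (L : 'I_n -> matroid 'I_m),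
    (forall i, P (L i)) /\ forall M, P M -> exists i, L i = M.
Proof.
pose T := {p : {set 'I_m} * {set {set 'I_m}} | matroid_axiom p.1 p.2}.
pose g (t : T) := Matroid (valP t); pose A := [set t | P (g t)].
exists #|A|, (fun i => g (enum_val i)); split=> [i|[S V ax] PM].
  by have := enum_valP i; rewrite inE.
pose t : T := exist (fun p => is_true (matroid_axiom p.1 p.2)) (S, V) ax.
have gt : g t = Matroid ax by rewrite /g; congr Matroid; apply: bool_irrelevance.
have tA : t \in A by rewrite inE gt.
by exists (enum_rank_in tA t); rewrite enum_rankK_in.
Qed.

Theorem theorem6p1 (k : nat) (hk : (2 <= k)%N) :
  (* a matroid has levelness <= k-1 iff it has no minimally k-level minor *)
  (forall (E : finType) (M : matroid E),
     (Lev M <= k.-1)%N <-> ~ (exists N : matroid E, is_minor N M /\ minimally_level k N))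
  /\
  (* finitely many minimally k-level matroids up to isomorphism *)
  (exists (n : nat) (L : 'I_n -> {m : nat & matroid 'I_m}),
     forall (E : finType) (M : matroid E),
       minimally_level k M -> exists i : 'I_n, matroid_iso M (projT2 (L i)))
  /\
  (* hence levelness <= k-1 is characterized by finitely many excluded minors *)
  (exists (n : nat) (L : 'I_n -> {m : nat & matroid 'I_m}),
     forall (E : finType) (M : matroid E),
       (Lev M <= k.-1)%N <->
       ~ (exists (i : 'I_n) (N : matroid E), is_minor N M /\ matroid_iso N (projT2 (L i)))).
Proof.
have ltk m : (m <= k.-1)%N = ~~ (k <= m)%N by rewrite -ltnNge; lia.
(* [iso_ordinal] targets ['I_b.+1], so [b.+1] is the size bound. *)
pose b := (2 * (k + 2 ^ k)).-1.
(* The list holds all matroids of levelness at least [k] of bounded size, not just the minimal ones: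
   it covers these, and each member is rightly excluded by monotonicity. *)
have [n [L [LP Lall]]] := matroids_enumerable (m := b.+1) (fun M => (k <= Lev M)%N).
pose L' i : {m : nat & matroid 'I_m} := existT _ b.+1 (L i).
have isoL (E : finType) (M : matroid E) :
    minimally_level k M -> exists i : 'I_n, matroid_iso M (projT2 (L' i)).
  move=> [LM hmin]; have [||_ cS] := minimal_Lev_card (M := M) hk.
  - by move=> N /hmin; rewrite LM.
  - by rewrite LM.
  have [|N iN] := @iso_ordinal _ M b; first by rewrite /b prednK // muln_gt0 addn_gt0 expn_gt0; lia.
  have [|i Li] := Lall N; first by rewrite -(matroid_iso_Lev iN) LM.
  by exists i; rewrite /= Li.
split=> [E M|]; last split; [|by exists n, L'|exists n, L' => E M].
  rewrite ltk; split=> [/negP h [N [NM [LN _]]]|h].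
    by apply: h; rewrite -LN is_minor_Lev.
  by apply/negP => kL; apply: h; apply: exists_minimal_minor.
rewrite ltk; split=> [/negP h [i [N [NM iN]]]|h].
  by apply: h; apply: leq_trans (is_minor_Lev NM); rewrite (matroid_iso_Lev iN) /= LP.
apply/negP => kL; apply: h; have [N [NM mN]] := exists_minimal_minor hk kL.
by have [i iN] := isoL _ _ mN; exists i, N.
Qed.
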